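(* Let $X$ and $Y$ be subproduct systems over $\mathbb N^2$. If $\mathcal A_X$ is continuously isomorphic to $\mathcal A_Y$ (i.e. there is a bounded algebra isomorphism $\mathcal A_X\to\mathcal A_Y$), then $k_X=k_Y$.
   Context: $\mathbb N=\{0,1,2,\dots\}$. A subproduct system (over $\mathbb N^2$) is a family $X=\{X(s)\}_{s\in\mathbb N^2}$ of finite-dimensional complex Hilbert spaces with $\dim X(0)=1$ (so $X(0)=\mathbb C$), together with coisometries $U_{s,t}:X(s)\otimes X(t)\to X(s+t)$, such that $U_{s,0},U_{0,s}$ are the natural isomorphisms and $U_{s+t,r}(U_{s,t}\otimes I_{X(r)})=U_{s,t+r}(I_{X(s)}\otimes U_{t,r})$ for all $s,t,r$. $\mathcal F_X=\bigoplus_{s}X(s)$ (Hilbert direct sum). For $\eta\in X(s)$, $L^{(s)}_\eta\in B(\mathcal F_X)$ is given by $L^{(s)}_\eta\xi=U_{s,t}(\eta\otimes\xi)$ for $\xi\in X(t)$. The tensor algebra $\mathcal A_X$ is the norm-closed subalgebra of $B(\mathcal F_X)$ generated by all $L^{(s)}_\eta$. The ideal $J_X$: let $E=X(1,0)$, $F=X(0,1)$ with orthonormal bases $\{e_i\}_{i=1}^m$, $\{f_j\}_{j=1}^n$; let $M_{(i,j)}:E^{\otimes i}\otimes F^{\otimes j}\to X(i,j)$ be the coisometry obtained by composing maps $U_{s,t}$; let $u:F\otimes E\to E\otimes F$ be a unitary with $U_{(1,0),(0,1)}u=U_{(0,1),(1,0)}$ (such $u$ exist), $u(f_j\otimes e_i)=\sum_{k,l}u_{(k,l),(i,j)}e_k\otimes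 f_l$. Then $J_X\subset\mathbb C[z_1,\dots,z_m,w_1,\dots,w_n]$ is the ideal generated by the polynomials $p_{i,j}=w_jz_i-\sum_{k,l}u_{(k,l),(i,j)}z_kw_l$ and all $q^x$ with $x\in\ker M_{(i,j)}$, $i,j\ge0$, where for $x=\sum a_{s_1\dots s_i}^{t_1\dots t_j}e_{s_1}\otimes\cdots\otimes e_{s_i}\otimes f_{t_1}\otimes\cdots\otimes f_{t_j}$ one sets $q^x=\sum a_{s_1\dots s_i}^{t_1\dots t_j}z_{s_1}\cdots z_{s_i}w_{t_1}\cdots w_{t_j}$. (A different $u$ gives the same ideal.) $k_X$ is the minimal positive (total) degree of polynomials in $J_X$; it does not depend on the choice of bases. $k_Y$ is defined in the same way from $Y$. *)

(* Defs.v *)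
From HB Require Import structures.
From mathcomp Require Import all_boot all_order all_algebra.
From mathcomp Require Import sesquilinear.
From mathcomp Require Import all_classical all_reals all_analysis.
From mathcomp Require Import complex ring.
(* The notations of mpoly clash with those of mathcomp-analysis. *)
From mathcomp Require mpoly.
Import (coercions, canonicals) mpoly.

Set Implicit Arguments.
Unset Strict Implicit.
Unset Printing Implicit Defensive.

Import Order.TTheory GRing.Theory Num.Theory Num.Def.

Local Open Scope classical_set_scope.
Local Open Scope ring_scope.

(* Finite dimensional complex Hilbert spaces (completeness is automatic); the
   inner product is linear in its first argument. *)
Record hilbert (R : realType) := Hilbert {
  hspace :> vectType R[i];
  hdot : {dot hspace for conjC}
}.

Definition sqnorm (R : realType) (H : hilbert R) (v : H) : R :=
  complex.Re (hdot H v v).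

Definition adjoint (R : realType) (H K : hilbert R)
    (f : 'Hom(H, K)) (g : 'Hom(K, H)) : Prop :=
  forall x y, hdot K (f x) y = hdot H x (g y).

Definition coisometry (R : realType) (H K : hilbert R) (f : 'Hom(H, K)) : Prop :=
  exists2 g, adjoint f g & cancel g f.

Definition unitary (R : realType) (H K : hilbert R) (f : 'Hom(H, K)) : Prop :=
  exists g, [/\ adjoint f g, cancel g f & cancel f g].

Definition orthonormal_basis (R : realType) (H : hilbert R) (n : nat)
    (b : n.-tuple H) : Prop :=
  orthonormal (hdot H) b /\ (<<b>> = fullv)%VS.

(* A realization of the Hilbert space tensor product H (x) K, which these
   properties determine up to a unique unitary compatible with tens. *)
Record tensor (R : realType) (H K : hilbert R) := Tensor {
  tspace :> hilbert R;
  tens : H -> K -> tspace;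
  tens_linl : forall b, linear (tens^~ b);
  tens_linr : forall a, linear (tens a);
  tens_dot : forall a a' b b',
    hdot tspace (tens a b) (tens a' b') = hdot H a a' * hdot K b b';
  tens_span : forall W : {vspace tspace},
    (forall a b, tens a b \in W) -> W = fullv
}.

(* X(0) = C is rendered by dim X(0) = 1 together with the unit vector [vac],
   so that l |-> l *: vac identifies C with X(0).  The maps
   [Umap s 0] and [Umap 0 s] are then the natural isomorphisms x (x) l |-> l x and
   l (x) x |-> l x, and the associativity of Umap is checked on the elementary
   tensors a (x) b (x) c. *)
Record subproduct_system (R : realType) := SubproductSystem {
  fiber :> nat * nat -> hilbert R;
  ftens : forall s t, tensor (fiber s) (fiber t);
  Umap : forall s t, 'Hom(ftens s t, fiber (s + t));
  vac : fiber 0;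
  dim_fiber0 : \dim {: fiber 0} = 1%N;
  vac_unit : hdot (fiber 0) vac vac = 1;
  Umap_coisometry : forall s t, coisometry (Umap s t);
  Umap_s0 : forall s (a : fiber s),
    ecast q (fiber q) (addr0 s) (Umap s 0 (tens (ftens s 0) a vac)) = a;
  Umap_0s : forall s (a : fiber s),
    ecast q (fiber q) (add0r s) (Umap 0 s (tens (ftens 0 s) vac a)) = a;
  Umap_assoc : forall s t r (a : fiber s) (b : fiber t) (c : fiber r),
    ecast q (fiber q) (addrA s t r)
      (Umap s (t + r) (tens (ftens s (t + r)) a (Umap t r (tens (ftens t r) b c))))
    = Umap (s + t) r (tens (ftens (s + t) r) (Umap s t (tens (ftens s t) a b)) c)
}.

Definition prodX (R : realType) (X : subproduct_system R) (s t : nat * nat)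
    (a : X s) (b : X t) : X (s + t) :=
  Umap X s t (tens (ftens X s t) a b).

(* Fock space *)

Definition square_summable (R : realType) (X : subproduct_system R)
    (xi : forall s, X s) : Prop :=
  (\esum_(s in [set: nat * nat]) (sqnorm (xi s))%:E < +oo)%E.

Record fock (R : realType) (X : subproduct_system R) := Fock {
  fval : forall s, X s;
  fvalP : square_summable fval
}.

Lemma fock_eq (R : realType) (X : subproduct_system R) (xi zeta : fock X) :
  (forall s, fval xi s = fval zeta s) -> xi = zeta.
Proof.
case: xi zeta => [x Px] [z Pz] /= e.
have xz : x = z by exact: functional_extensionality_dep.
by subst z; rewrite (Prop_irrelevance Px Pz).
Qed.

Section FockModule.
Variables (R : realType) (X : subproduct_system R).
Implicit Types (xi zeta : fock X).

Lemma sqnorm_ge0 (H : hilbert R) (v : H) : 0 <= sqnorm v.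
Proof. by have := dnorm_ge0 (hdot H) v; rewrite lecE => /andP[]. Qed.

Lemma sqnorm0 (H : hilbert R) : sqnorm (0 : H) = 0.
Proof. by rewrite /sqnorm linear0l. Qed.

Lemma sqnormZ (H : hilbert R) (a : R[i]) (v : H) :
  sqnorm (a *: v) = complex.Re (`|a| ^+ 2) * sqnorm v.
Proof.
rewrite /sqnorm dnormZ.
have := dnorm_ge0 (hdot H) v; case: (hdot H v v) => p q; rewrite lecE.
move=> /andP[/eqP/= -> _].
by rewrite /=; ring.
Qed.

Lemma sqnormD_le (H : hilbert R) (u v : H) :
  sqnorm (u + v) <= 2 * (sqnorm u + sqnorm v).
Proof.
have <- : sqnorm (u + v) + sqnorm (u - v) = 2 * (sqnorm u + sqnorm v).
  rewrite /sqnorm dnormD dnormB.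
  set d := hdot H u v + _; case: (hdot H u u) (hdot H v v) d => [a ?] [b ?] [d ?].
  by rewrite /=; ring.
by rewrite lerDl sqnorm_ge0.
Qed.

Lemma square_summable_le (x : forall s, X s) (r : nat * nat -> R) (c : R) :
  0 <= c -> (forall s, 0 <= r s) ->
  (\esum_(s in [set: nat * nat]) (r s)%:E < +oo)%E ->
  (forall s, sqnorm (x s) <= c * r s) -> square_summable x.
Proof.
move=> c0 r0 rfin le; rewrite /square_summable.
apply: (@le_lt_trans _ _ (c%:E * \esum_(s in [set: nat * nat]) (r s)%:E)%E).
  apply: ge_ereal_sup => _ /= [A [Afin _] <-].
  apply: (@le_trans _ _ (c%:E * \sum_(s \in A) (r s)%:E)%E).
    rewrite ge0_mule_fsumr; last by move=> s; rewrite lee_fin.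
    by apply: lee_fsum => // s _; rewrite -EFinM lee_fin.
  rewrite lee_wpmul2l ?lee_fin//.
  by apply: ereal_sup_ubound; exists A.
by apply: lte_mul_pinfty => //; rewrite lee_fin.
Qed.

Lemma square_summable0 : square_summable (fun s => 0 : X s).
Proof.
by rewrite /square_summable esum1 // => s _; rewrite sqnorm0.
Qed.

Lemma square_summableD xi zeta :
  square_summable (fun s => fval xi s + fval zeta s).
Proof.
apply: (@square_summable_le _
  (fun s => sqnorm (fval xi s) + sqnorm (fval zeta s)) 2) => //.
- by move=> s; rewrite addr_ge0 ?sqnorm_ge0.
- under eq_esum do rewrite EFinD.
  rewrite esumD; try by move=> s _; rewrite lee_fin sqnorm_ge0.
  by apply: lte_add_pinfty; exact: fvalP.
- by move=> s; exact: sqnormD_le.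
Qed.

Lemma square_summableZ (a : R[i]) xi : square_summable (fun s => a *: fval xi s).
Proof.
apply: (@square_summable_le _ (fun s => sqnorm (fval xi s))
  (complex.Re (`|a| ^+ 2))).
- have : 0 <= `|a| ^+ 2 by rewrite exprn_ge0.
  by rewrite lecE => /andP[].
- by move=> s; exact: sqnorm_ge0.
- exact: fvalP.
- by move=> s; rewrite sqnormZ.
Qed.

Lemma square_summableN xi : square_summable (fun s => - fval xi s).
Proof.
have := square_summableZ (-1) xi.
by under [X in square_summable X]functional_extensionality_dep do rewrite scaleN1r.
Qed.

Lemma square_summable_dfwith t (x : X t) :
  square_summable (eqtype.dfwith (fun s => 0 : X s) x).
Proof.
rewrite /square_summable (esumID [set t]); last first.
  by move=> s _; rewrite lee_fin sqnorm_ge0.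
rewrite setTI esum_set1 ?lee_fin ?sqnorm_ge0// [X in (_ + X)%E]esum1 ?adde0 ?ltry//.
by move=> s [_ /= ts]; rewrite dfwith_out ?sqnorm0//; apply/eqP => e; apply: ts.
Qed.

Definition fock0 : fock X := Fock square_summable0.
Definition fockD xi zeta : fock X := Fock (square_summableD xi zeta).
Definition fockN xi : fock X := Fock (square_summableN xi).
Definition fockZ a xi : fock X := Fock (square_summableZ a xi).

Definition incl t (x : X t) : fock X := Fock (square_summable_dfwith x).

HB.instance Definition _ := gen_eqMixin (fock X).
HB.instance Definition _ := gen_choiceMixin (fock X).

Fact fockDA : associative fockD.
Proof. by move=> x y z; apply: fock_eq => s /=; rewrite addrA. Qed.
Fact fockDC : commutative fockD.
Proof. by move=> x y; apply: fock_eq => s /=; rewrite addrC. Qed.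
Fact fock0D : left_id fock0 fockD.
Proof. by move=> x; apply: fock_eq => s /=; rewrite add0r. Qed.
Fact fockND : left_inverse fock0 fockN fockD.
Proof. by move=> x; apply: fock_eq => s /=; rewrite addNr. Qed.

HB.instance Definition _ :=
  GRing.isZmodule.Build (fock X) fockDA fockDC fock0D fockND.

Fact fockZA a b xi : fockZ a (fockZ b xi) = fockZ (a * b) xi.
Proof. by apply: fock_eq => s /=; rewrite scalerA. Qed.
Fact fock1Z : left_id 1 fockZ.
Proof. by move=> x; apply: fock_eq => s /=; rewrite scale1r. Qed.
Fact fockZDr : right_distributive fockZ +%R.
Proof. by move=> a x y; apply: fock_eq => s /=; rewrite scalerDr. Qed.
Fact fockZDl xi : {morph fockZ^~ xi : a b / a + b}.
Proof. by move=> a b; apply: fock_eq => s /=; rewrite scalerDl. Qed.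

HB.instance Definition _ :=
  GRing.Zmodule_isLmodule.Build R[i] (fock X) fockZA fock1Z fockZDr fockZDl.

Definition fnorm xi : R :=
  Num.sqrt (fine (\esum_(s in [set: nat * nat]) (sqnorm (fval xi s))%:E)).

End FockModule.

(* The tensor algebra.  Operators on the Fock space are plain functions, with
   the pointwise linear structure and composition as product; B(F_X) is the set
   [bounded_operator]. *)
Section TensorAlgebra.
Variables (R : realType) (X : subproduct_system R).
Implicit Types (S T : fock X -> fock X) (A : set (fock X -> fock X)).

Definition bounded_operator T : Prop :=
  linear T /\ exists M : R, forall xi, fnorm (T xi) <= M * fnorm xi.

(* Meaningful for bounded operators only: sup is 0 on unbounded sets. *)
Definition opnorm T : R := sup [set fnorm (T xi) | xi in [set xi | fnorm xi <= 1]].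

(* A bounded operator is determined by its values on the summands X(t). *)
Definition creation_operators : set (fock X -> fock X) :=
  [set T | bounded_operator T /\
    exists s (eta : X s), forall t (xi : X t), T (incl xi) = incl (prodX eta xi)].

Definition closed_subalgebra A : Prop :=
  [/\ A `<=` bounded_operator,
      A 0,
      (forall (a : R[i]) S T, A S -> A T -> A (a *: S + T)),
      (forall S T, A S -> A T -> A (S \o T)) &
      (forall T, bounded_operator T ->
        (forall eps : R, 0 < eps -> exists2 S, A S & opnorm (T - S) < eps) ->
        A T)].

Definition tensor_algebra : set (fock X -> fock X) :=
  smallest closed_subalgebra creation_operators.

End TensorAlgebra.

Arguments creation_operators {R} X _.
Arguments tensor_algebra {R} X _.

Definition bounded_algebra_isomorphism (R : realType) (X Y : subproduct_system R)
    (Phi : (fock X -> fock X) -> (fock Y -> fock Y)) : Prop :=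
  [/\ set_bij (tensor_algebra X) (tensor_algebra Y) Phi,
      (forall (a : R[i]) S T, tensor_algebra X S -> tensor_algebra X T ->
        Phi (a *: S + T) = a *: Phi S + Phi T),
      (forall S T, tensor_algebra X S -> tensor_algebra X T ->
        Phi (S \o T) = Phi S \o Phi T) &
      (exists M : R, forall T, tensor_algebra X T ->
        opnorm (Phi T) <= M * opnorm T)].

(* The function Phi is relevant on the tensor algebra of X only. *)
Definition continuously_isomorphic (R : realType) (X Y : subproduct_system R) :=
  exists Phi, @bounded_algebra_isomorphism R X Y Phi.

(* The choices entering the definition of J_X: orthonormal bases (e_i) of
   E = X(1,0) and (f_j) of F = X(0,1), and the unitary u : F (x) E -> E (x) F.
   X((1,0) + (0,1)) and X((0,1) + (1,0)) are both convertible to X(1,1). *)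
Record frame (R : realType) (X : subproduct_system R) := Frame {
  dimE : nat;
  dimF : nat;
  basisE : dimE.-tuple (X (1%N, 0%N));
  basisF : dimF.-tuple (X (0%N, 1%N));
  basisE_onb : orthonormal_basis basisE;
  basisF_onb : orthonormal_basis basisF;
  swap : 'Hom(ftens X (0%N, 1%N) (1%N, 0%N), ftens X (1%N, 0%N) (0%N, 1%N));
  swap_unitary : unitary swap;
  swapP : forall y : ftens X (0%N, 1%N) (1%N, 0%N),
    Umap X (1%N, 0%N) (0%N, 1%N) (swap y) = Umap X (0%N, 1%N) (1%N, 0%N) y
}.

Section Ideal.
Variables (R : realType) (X : subproduct_system R) (B : frame X).

Local Notation m := (dimE B).
Local Notation n := (dimF B).
Local Notation e := (tnth (basisE B)).
Local Notation f := (tnth (basisF B)).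

(* C[z_1, ..., z_m, w_1, ..., w_n] *)
Local Notation P := (mpoly.mpoly (m + n) R[i]).

Definition zvar (k : 'I_m) : P := mpoly.mpolyX R[i] (mpoly.mnm1 (lshift n k)).
Definition wvar (l : 'I_n) : P := mpoly.mpolyX R[i] (mpoly.mnm1 (rshift m l)).

(* The image in X(i,0) of e_(s 0) (x) ... (x) e_(s (i-1)), and likewise for f. *)
Fixpoint wordE (i : nat) : ('I_i -> 'I_m) -> X (i, 0%N) :=
  match i return ('I_i -> 'I_m) -> X (i, 0%N) with
  | 0%N => fun=> vac X
  | i'.+1 => fun s =>
      @prodX R X (1%N, 0%N) (i', 0%N) (e (s ord0)) (wordE (s \o lift ord0))
  end.

Fixpoint wordF (j : nat) : ('I_j -> 'I_n) -> X (0%N, j) :=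
  match j return ('I_j -> 'I_n) -> X (0%N, j) with
  | 0%N => fun=> vac X
  | j'.+1 => fun t =>
      @prodX R X (0%N, 1%N) (0%N, j') (f (t ord0)) (wordF (t \o lift ord0))
  end.

(* A vector of E^{(x)i} (x) F^{(x)j} is given by its coordinates in the basis
   e_(s 0) (x) ... (x) e_(s (i-1)) (x) f_(t 0) (x) ... (x) f_(t (j-1)). *)
Definition coords (i j : nat) : Type :=
  {ffun 'I_i -> 'I_m} -> {ffun 'I_j -> 'I_n} -> R[i].

Definition Mmap (i j : nat) (a : coords i j) : X ((i, 0%N) + (0%N, j)) :=
  \sum_s \sum_t a s t *: prodX (wordE s) (wordF t).

Definition qpoly (i j : nat) (a : coords i j) : P :=
  \sum_s \sum_t a s t *: ((\prod_k zvar (s k)) * (\prod_l wvar (t l))).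

(* u_{(k,l),(i,j)} *)
Definition swap_coef (k : 'I_m) (l : 'I_n) (i : 'I_m) (j : 'I_n) : R[i] :=
  hdot _ (swap B (tens _ (f j) (e i))) (tens (ftens X _ _) (e k) (f l)).

Definition ppoly (i : 'I_m) (j : 'I_n) : P :=
  wvar j * zvar i - \sum_k \sum_l swap_coef k l i j *: (zvar k * wvar l).

Definition ideal (I : set P) : Prop :=
  [/\ I 0, (forall p q, I p -> I q -> I (p + q)) & (forall p q, I q -> I (p * q))].

Definition idealJ : set P :=
  smallest ideal
    ([set p | exists i j, p = ppoly i j] `|`
     [set p | exists i j (a : coords i j), Mmap a = 0 /\ p = qpoly a]).

(* msize p is 1 + the total degree of p for p <> 0, and msize 0 = 0. *)
Definition idealJ_degree (d : nat) : Prop :=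
  exists2 p, idealJ p & mpoly.msize p = d.+1.

(* k_X, with [None] for the minimum of the empty set. *)
Definition kinv : option nat :=
  match pselect (exists d, (0 < d)%N && `[< idealJ_degree d >]) with
  | left ex => Some (ex_minn ex)
  | right _ => None
  end.

End Ideal.

(* Main.v *)
Require Import Defs.
From HB Require Import structures.
From mathcomp Require Import all_boot all_order all_algebra zify.
From mathcomp Require mpoly.

(** Let [d_X] be the number of variables of the polynomial ring of [X], and say
    that a polynomial vanishes to order [k] at a point when its Taylor
    expansion there has no terms of degree less than [k]. The theorem holds
    because [k_X] can be read off the tensor algebra without reference to the
    vacuum: it is the largest [k] such that at some character there are as many
    jets of order less than [k] as for the whole polynomial ring. The vacuum
    attains the maximum, the ideal being homogeneous; no character does better,
    since a nonzero polynomial of degree [r] vanishes nowhere to order more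
    than [r].

    Suppose that the ideal of [Y] has no nonzero element of degree less than
    [k]. Sending the words of length less than [k] to the corresponding
    monomials is then a well-defined operation, and [T |-> T vac] followed by it
    is a bounded homomorphism from the tensor algebra of [Y] onto the
    polynomials in [d_Y] variables modulo degree [k] ([symbol_mul]). Compose it
    with a bounded homomorphism of the tensor algebra of [X] onto that of [Y].
    The images [b_i] of the generators of [X] satisfy every relation of the
    ideal of [X] ([idealJ_image]). Polynomials in the generators are dense and
    the target is finite dimensional, so the [b_i] generate the target. Their
    constant terms form an arbitrary point [c] of the variety, as nothing forces
    the vacuum to be preserved; but the differences [b_i - c_i] are nilpotent,
    so that their monomials of degree less than [k] already span. Counting
    dimensions for [k = 2] gives [d_Y <= d_X]. When [d_X = d_Y] these monomials
    are independent, that is, every polynomial [g] with [g(b) = 0] vanishes to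
    order [k] at [c]; if it is not zero, its degree is then at least [k]. Hence
    the ideal of [X] has no nonzero element of degree less than [k] either
    ([transfer_card], [transfer_no_small_relation]).

    There are never relations of degree less than [2] ([no_small_relation2]), so
    the case [k = 2] always applies. The isomorphism of the theorem is bounded
    in one direction only; the open mapping theorem ([open_mapping]) bounds its
    inverse, since tensor algebras are complete. The argument then applies in
    both directions and gives [d_X = d_Y] and [k_X = k_Y].

    The estimates rest on one remark: tensor products and coisometric images of
    Parseval frames are Parseval frames, so the words span each fibre with
    coordinates that are given by inner products ([wordE_parseval]). *)

Set Implicit Arguments.
Unset Strict Implicit.
Unset Printing Implicit Defensive.

Import GRing.Theory.
Local Open Scope ring_scope.

(** * Polynomials modulo high degrees *)

Module TruncatedPolynomials.
Import mpoly.

Section Vanish.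
Variables (F : fieldType) (n : nat).
Implicit Types (p q : {mpoly F[n]}) (k : nat).

(** Membership in the [k]-th power of the ideal of the origin. *)
Definition vanish k p : Prop := forall m, (mdeg m < k)%N -> p@_m = 0.

Lemma vanish0 k : vanish k 0.
Proof. by move=> m _; rewrite mcoeff0. Qed.

Lemma vanishD k p q : vanish k p -> vanish k q -> vanish k (p + q).
Proof. by move=> hp hq m km; rewrite mcoeffD hp ?hq ?addr0. Qed.

Lemma vanishZ k c p : vanish k p -> vanish k (c *: p).
Proof. by move=> hp m km; rewrite mcoeffZ hp ?mulr0. Qed.

Lemma vanishN k p : vanish k p -> vanish k (- p).
Proof. by move=> hp m km; rewrite mcoeffN hp ?oppr0. Qed.

Lemma vanishB k p q : vanish k p -> vanish k q -> vanish k (p - q).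
Proof. by move=> hp hq; apply/vanishD/vanishN. Qed.

Lemma vanish_sum k (I : Type) (r : seq I) (P : pred I) (f : I -> {mpoly F[n]}) :
  (forall i, P i -> vanish k (f i)) -> vanish k (\sum_(i <- r | P i) f i).
Proof.
move=> hf; apply: (big_ind (vanish k)) => //; [exact: vanish0|exact: vanishD].
Qed.

Lemma vanish_leq k l p : (l <= k)%N -> vanish k p -> vanish l p.
Proof. by move=> lk hp m ml; apply/hp/(leq_trans ml). Qed.

Lemma vanish_mul k l p q : vanish k p -> vanish l q -> vanish (k + l) (p * q).
Proof.
move=> hp hq m hm; rewrite mcoeffM big1 // => -[a b] /= /eqP e.
have [ak|ka] := ltnP (mdeg a) k; first by rewrite hp ?mul0r.
have md : mdeg m = (mdeg a + mdeg b)%N by rewrite {1}e mdegD.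
by rewrite hq ?mulr0 //; lia.
Qed.

Lemma vanishM k p q : vanish k q -> vanish k (p * q).
Proof. by move=> hq; rewrite -[k]add0n; apply: vanish_mul. Qed.

Lemma vanishX i : vanish 1 'X_i.
Proof.
move=> m; rewrite ltnS leqn0 mdeg_eq0 => /eqP ->; rewrite mcoeffX.
by rewrite mnm1_eq0.
Qed.

Lemma vanish_exp p e : vanish 1 p -> vanish e (p ^+ e).
Proof.
move=> hp; elim: e => [|e IH]; first by move=> m; rewrite ltn0.
by rewrite exprS; apply: (@vanish_mul 1 e).
Qed.

Lemma vanish_prod (I : finType) (f : I -> {mpoly F[n]}) (e : I -> nat) :
  (forall i, vanish (e i) (f i)) -> vanish (\sum_i e i) (\prod_i f i).
Proof.
move=> hf; apply: (big_ind2 (fun p e => vanish e p)) => //.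
by move=> p k q l; exact: vanish_mul.
Qed.

Lemma vanish_sub_const p : vanish 1 (p - (p@_0%MM)%:MP).
Proof.
move=> m; rewrite ltnS leqn0 mdeg_eq0 => /eqP ->.
by rewrite mcoeffB mcoeffC eqxx mulr1 subrr.
Qed.

Lemma vanish_small k p : vanish k p -> (msize p <= k)%N -> p = 0.
Proof.
move=> hp sp; apply/mpolyP => m; rewrite mcoeff0.
have [|km] := ltnP (mdeg m) k; first exact: hp.
by apply/eqP; rewrite mcoeff_eq0; apply/msize_mdeg_ge/(leq_trans sp).
Qed.

Lemma msizeM_leq k l p q :
  (msize p <= k.+1)%N -> (msize q <= l.+1)%N -> (msize (p * q) <= (k + l).+1)%N.
Proof.
have [->|p0] := eqVneq p 0; first by rewrite mul0r msize0.
have [->|q0] := eqVneq q 0; first by rewrite mulr0 msize0.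
by rewrite msizeM // -subn1 leq_subLR; move=> hp hq; have := leq_add hp hq; rewrite addSn addnS add1n.
Qed.

Lemma msize_exp_leq p e : (msize p <= 2)%N -> (msize (p ^+ e) <= e.+1)%N.
Proof.
move=> hp; elim: e => [|e IH]; first by rewrite expr0 msize1.
by rewrite exprS; apply: (@msizeM_leq 1 e).
Qed.

Lemma msize_prod_leq (I : finType) (f : I -> {mpoly F[n]}) (e : I -> nat) :
  (forall i, (msize (f i) <= (e i).+1)%N) ->
  (msize (\prod_i f i) <= (\sum_i e i).+1)%N.
Proof.
move=> hf; apply: (big_ind2 (fun p e => (msize p <= e.+1)%N)) => //.
  by rewrite msize1.
by move=> p k q l; exact: msizeM_leq.
Qed.

Lemma msize_sum_leq k (I : Type) (r : seq I) (P : pred I) (f : I -> {mpoly F[n]}) :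
  (forall i, P i -> (msize (f i) <= k)%N) -> (msize (\sum_(i <- r | P i) f i) <= k)%N.
Proof.
move=> hf; apply: (big_ind (fun p => (msize p <= k)%N)) => //.
  by rewrite msize0.
by move=> p q hp hq; apply: (leq_trans (msizeD_le _ _)); rewrite geq_max hp.
Qed.

Definition cong k p q : Prop := vanish k (p - q).

Lemma cong_refl k p : cong k p p.
Proof. by rewrite /cong subrr; apply: vanish0. Qed.

Lemma cong_sym k p q : cong k p q -> cong k q p.
Proof. by move=> /vanishN; rewrite opprB. Qed.

Lemma cong_trans k p q r : cong k p q -> cong k q r -> cong k p r.
Proof. by move=> h1 h2; have := vanishD h1 h2; rewrite addrA subrK. Qed.

Lemma congD k p q p' q' : cong k p q -> cong k p' q' -> cong k (p + p') (q + q').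
Proof. by move=> h1 h2; have := vanishD h1 h2; rewrite addrACA -opprD. Qed.

Lemma congN k p q : cong k p q -> cong k (- p) (- q).
Proof. by move=> /vanishN; rewrite opprD. Qed.

Lemma congZ k c p q : cong k p q -> cong k (c *: p) (c *: q).
Proof. by move=> h; have := vanishZ c h; rewrite scalerBr. Qed.

Lemma congM k p q p' q' : cong k p q -> cong k p' q' -> cong k (p * p') (q * q').
Proof.
move=> h1 h2; have := vanishD (vanishM p h2) (vanishM q' h1).
by rewrite !mulrBr [q' * p]mulrC [q' * q]mulrC addrA subrK.
Qed.

Lemma cong_sum k (I : Type) (r : seq I) (P : pred I) (f g : I -> {mpoly F[n]}) :
  (forall i, P i -> cong k (f i) (g i)) ->
  cong k (\sum_(i <- r | P i) f i) (\sum_(i <- r | P i) g i).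
Proof. by move=> h; rewrite /cong -sumrB; apply: vanish_sum. Qed.

Lemma cong0 k p : cong k p 0 <-> vanish k p.
Proof. by rewrite /cong subr0. Qed.

End Vanish.

Section Comp.
Variables (F : fieldType) (d n : nat).
Implicit Types (g : {mpoly F[d]}) (b : d.-tuple {mpoly F[n]}).

(** Linear combinations come in the form [a *: p + q], in which subalgebras of
    operators are closed under them. *)
Lemma comp_mpoly_ind (P : {mpoly F[d]} -> Prop) :
  P 1 -> (forall (a : F) p q, P p -> P q -> P (a *: p + q)) ->
  (forall p q, P p -> P q -> P (p * q)) -> (forall i, P 'X_i) -> forall g, P g.
Proof.
move=> P1 Plin PM PX g.
have P0 : P 0 by rewrite -(addNr 1) -scaleN1r; apply: Plin.
elim/mpolyind: g => // c m p _ _ Pp; apply: Plin => //.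
rewrite mpolyXE_id; apply: (big_ind P) => // i _.
by elim: (m i) => [|e IH]; rewrite ?expr0 // exprS; apply: PM.
Qed.

Lemma comp_mpolyA (e : nat) g (a : d.-tuple {mpoly F[e]}) (b : e.-tuple {mpoly F[n]}) :
  (g \mPo a) \mPo b = g \mPo [tuple of [seq p \mPo b | p <- a]].
Proof.
elim/comp_mpoly_ind: g => [|c p q Hp Hq|p q Hp Hq|i].
- by rewrite !rmorph1.
- by rewrite !linearP /= Hp Hq.
- by rewrite !rmorphM /= Hp Hq.
- by rewrite !comp_mpolyXU -!tnth_nth tnth_map.
Qed.

Lemma msize_comp_leq g (a : d.-tuple {mpoly F[n]}) :
  (forall i, (msize (tnth a i) <= 2)%N) -> (msize (g \mPo a) <= msize g)%N.
Proof.
move=> ha; rewrite comp_mpolyE big_seq_cond.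
apply: msize_sum_leq => m; rewrite andbT => mg.
apply: (leq_trans (msizeZ_le _ _)); apply: leq_trans (msize_mdeg_lt mg).
by rewrite mdegE; apply: msize_prod_leq => i; apply: msize_exp_leq.
Qed.

End Comp.

Section Dimension.
Variables (F : fieldType) (d n k : nat) (b : d.-tuple {mpoly F[n]}).

(* Substituting [b] is translating by the constant terms [c] and then
   substituting the nilpotent part [nb]. The translation and its inverse do not
   raise degrees. *)
Let c i : F := (tnth b i)@_0%MM.
Let nb : d.-tuple {mpoly F[n]} := [tuple tnth b i - (c i)%:MP | i < d].
Let up : d.-tuple {mpoly F[d]} := [tuple 'X_i + (c i)%:MP | i < d].
Let down : d.-tuple {mpoly F[d]} := [tuple 'X_i - (c i)%:MP | i < d].

Local Lemma up_down g : (g \mPo up) \mPo down = g.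
Proof.
rewrite comp_mpolyA -[RHS]comp_mpoly_id; congr (_ \mPo _).
apply: eq_from_tnth => i; rewrite tnth_map !tnth_mktuple.
by rewrite linearD /= comp_mpolyXU comp_mpolyC -tnth_nth tnth_mktuple subrK.
Qed.

Local Lemma up_nb g : (g \mPo up) \mPo nb = g \mPo b.
Proof.
rewrite comp_mpolyA; congr (_ \mPo _).
apply: eq_from_tnth => i; rewrite tnth_map !tnth_mktuple.
by rewrite linearD /= comp_mpolyXU comp_mpolyC -tnth_nth tnth_mktuple subrK.
Qed.

Local Lemma down_b g : (g \mPo down) \mPo b = g \mPo nb.
Proof.
rewrite comp_mpolyA; congr (_ \mPo _).
apply: eq_from_tnth => i; rewrite tnth_map !tnth_mktuple.
by rewrite linearB /= comp_mpolyXU comp_mpolyC -tnth_nth.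
Qed.

Local Lemma msize_up g : (msize (g \mPo up) <= msize g)%N.
Proof.
apply: msize_comp_leq => i; rewrite tnth_mktuple (leq_trans (msizeD_le _ _)) //.
by rewrite msizeX mdeg1 msizeC; case: (_ == 0).
Qed.

Local Notation bm e := ('X_{1..e < k}).

Definition mon e (v : 'I_#|{: bm e}|) : 'X_{1..e} := bmnm (enum_val v).

(* The rows are the monomials of degree less than [k] in [nb], truncated. *)
Let A : 'M[F]_(#|{: bm d}|, #|{: bm n}|) :=
  \matrix_(u, v) ('X_[mon u] \mPo nb)@_(mon v).

Let vec (p : {mpoly F[n]}) : 'rV[F]_#|{: bm n}| := \row_v p@_(mon v).

Local Lemma vecP p q : vec p = vec q <-> vanish k (p - q).
Proof.
split=> [/rowP e m mk|e]; last first.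
  apply/rowP => v; rewrite !mxE; apply/eqP; rewrite -subr_eq0 -mcoeffB e //.
  exact: bmdeg.
have := e (enum_rank (BMultinom mk)); rewrite !mxE /mon enum_rankK /= => e'.
by rewrite mcoeffB e' subrr.
Qed.

(** Monomials of degree at least [k] in [nb] vanish to order [k], so only the
    small coefficients of [g] contribute. *)
Local Lemma vec_comp (g : {mpoly F[d]}) :
  vec (g \mPo nb) = (\row_u g@_(mon u)) *m A.
Proof.
apply/rowP => v; rewrite !mxE.
rewrite comp_mpolyEX raddf_sum /=.
under eq_bigr do rewrite mcoeffZ.
under [RHS]eq_bigr do rewrite !mxE.
rewrite -(reindex enum_val (P := xpredT)
   (F := fun u : bm d => g@_u * ('X_[u] \mPo nb)@_(mon v))) /=; last first.
  by exists enum_rank => i _; rewrite ?enum_valK ?enum_rankK.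
(* The entries of [nb] have no constant term. *)
have big0 (m : 'X_{1..d}) : (k <= mdeg m)%N -> ('X_[m] \mPo nb)@_(mon v) = 0.
  move=> km; suff : vanish (mdeg m) ('X_[m] \mPo nb).
    by apply; apply: (leq_trans _ km); apply: bmdeg.
  rewrite comp_mpolyX mdegE; apply: vanish_prod => i; apply: vanish_exp.
  by rewrite tnth_mktuple; apply: vanish_sub_const.
rewrite (bigID (fun m : 'X_{1..d} => mdeg m < k)%N) /= [X in _ + X]big1_seq ?addr0; last first.
  by move=> m; rewrite -leqNgt => /andP[km _]; rewrite big0 ?mulr0.
rewrite [RHS](bigID (fun m : bm d => val m \in msupp g)) /= [X in _ + X]big1 ?addr0; last first.
  by move=> m; rewrite -mcoeff_eq0 => /eqP ->; rewrite mul0r.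
rewrite -big_filter -[RHS](big_map val (fun m => m \in msupp g)
   (fun m => g@_m * ('X_[m] \mPo nb)@_(mon v))) -[RHS]big_filter.
apply: perm_big; apply: uniq_perm.
- by rewrite filter_uniq // msupp_uniq.
- by rewrite filter_uniq // map_inj_uniq ?index_enum_uniq //; exact: val_inj.
move=> m; rewrite !mem_filter andbC; case: (m \in msupp g) => //=.
apply/idP/mapP => [mk|[u _ ->]]; last exact: bmdeg.
by exists (BMultinom mk); rewrite // mem_index_enum.
Qed.

Lemma span_comp p :
  (exists g, vanish k (p - (g \mPo b))) <-> (vec p <= A)%MS.
Proof.
split=> [[g /vecP ->]|/submxP[r e]].
  by rewrite -up_nb vec_comp submxMl.
pose E (m : 'X_{1..d}) := if insub m is Some u then r 0 (enum_rank (u : bm d)) else 0.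
exists ((\sum_(m : bm d) E m *: 'X_[m]) \mPo down); apply/vecP.
rewrite e down_b vec_comp; congr (_ *m _); apply/rowP => u; rewrite mxE.
by rewrite mcoeff_mpoly ?bmdeg // /E /mon valK enum_valK.
Qed.

(** Finitely many linear equations on the coefficients cut out the image of a
    substitution; over the complex numbers this makes the image closed. *)
Lemma comp_mpoly_span_closed :
  exists K : 'M[F]_#|{: bm n}|, forall p : {mpoly F[n]},
  (exists g, vanish k (p - (g \mPo b))) <->
  forall j, \sum_v p@_(mon v) * K v j = 0.
Proof.
exists (cokermx A) => p; rewrite span_comp submxE.
have E j : (vec p *m cokermx A) 0 j = \sum_v p@_(mon v) * cokermx A v j.
  by rewrite mxE; apply: eq_bigr => v _; rewrite mxE.
rewrite -[X in X <-> _]/(is_true (vec p *m cokermx A == 0)).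
split=> [/eqP e j|e]; first by rewrite -E e mxE.
by apply/eqP/rowP => j; rewrite E e mxE.
Qed.

Hypothesis onto : forall p, exists g, vanish k (p - (g \mPo b)).

Let full : \rank A = #|{: bm n}|.
Proof.
apply/eqP; rewrite -[_ == _]/(row_full A) -sub1mx; apply/row_subP => i.
have [g] := onto 'X_[mon i]; move/vecP => e.
have -> : row i 1%:M = vec 'X_[mon i].
  apply/rowP => j; rewrite !mxE mcoeffX; congr (_%:R).
  by rewrite /mon -bmeqP (inj_eq enum_val_inj).
by rewrite e -up_nb vec_comp submxMl.
Qed.

Lemma comp_mpoly_onto_card : (#|{: bm n}| <= #|{: bm d}|)%N.
Proof. by rewrite -full rank_leq_row. Qed.

(** Equal numbers of monomials make the surjective [A] square and hence
    injective. *)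
Lemma comp_mpoly_onto_inj : n = d ->
  forall g, (msize g <= k)%N -> vanish k (g \mPo b) -> g = 0.
Proof.
move=> nd g gk; rewrite -[X in vanish k X]subr0 => /vecP.
have -> : vec 0 = 0 by apply/rowP => v; rewrite !mxE mcoeff0.
have free : row_free A by rewrite -row_leq_rank full nd.
rewrite -up_nb vec_comp => /eqP; rewrite mulmx_free_eq0 // => /eqP /rowP e.
have up0 : g \mPo up = 0.
  apply: (@vanish_small _ _ k) => [m mk|]; last exact: leq_trans (msize_up g) gk.
  by have := e (enum_rank (BMultinom mk)); rewrite !mxE /mon enum_rankK.
by rewrite -(up_down g) up0 comp_mpoly0.
Qed.

End Dimension.

Lemma card_bmultinom2 n : #|{: 'X_{1..n < 2}}| = n.+1.
Proof.
have h0 : (mdeg (0%MM : 'X_{1..n}) < 2)%N by rewrite mdeg0.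
have h1 (i : 'I_n) : (mdeg U_(i)%MM < 2)%N by rewrite mdeg1.
pose f (o : option 'I_n) : 'X_{1..n < 2} :=
  if o is Some i then BMultinom (h1 i) else BMultinom h0.
have /bij_eq_card <- : bijective f; last by rewrite card_option card_ord.
have f_inj : injective f.
  case=> [i|] [j|] //= /(congr1 (@bmnm _ _)) /= /eqP.
  - by rewrite eq_mnm1 => /eqP ->.
  - by rewrite mnm1_eq0.
  - by rewrite eq_sym mnm1_eq0.
apply: inj_card_bij => //; rewrite -(card_codom f_inj).
apply/subset_leq_card/subsetP => -[m mk] _; apply/codomP.
have := mk; rewrite ltnS leq_eqVlt ltnS leqn0 => /orP[/mdeg1P[i /eqP]|].
  by move=> e; exists (Some i); apply/val_inj.
by rewrite mdeg_eq0 => /eqP e; exists None; apply/val_inj.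
Qed.

End TruncatedPolynomials.

From mathcomp Require Import sesquilinear.
From mathcomp Require Import all_classical all_reals all_analysis.
From mathcomp Require Import complex ring lra.
Import (coercions, canonicals) mpoly.
Import Order.TTheory GRing.Theory Num.Theory Num.Def.
Import ComplexField.Normc.
Import TruncatedPolynomials Defs.

Local Open Scope classical_set_scope.
Local Open Scope ring_scope.

(** * Banach spaces and the open mapping theorem *)

Section Modulus.
Variable R : realType.
Implicit Types (z : R[i]) (x : R).

Lemma normC_normc z : `|z| = ((normc z)%:C)%C.
Proof. by case: z. Qed.

Lemma normc_ge0 z : 0 <= normc z.
Proof. by case: z => a b; rewrite sqrtr_ge0. Qed.

Lemma normc_real x : normc (x%:C)%C = `|x|.
Proof. by rewrite /normc /= expr0n /= addr0 sqrtr_sqr. Qed.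

Lemma normc_sum (I : Type) (r : seq I) (P : pred I) (f : I -> R[i]) :
  normc (\sum_(i <- r | P i) f i) <= \sum_(i <- r | P i) normc (f i).
Proof.
elim/big_rec2: _ => [|i y x _ h]; first by rewrite normc0.
by apply: (le_trans (le_normcD _ _)); rewrite lerD2l.
Qed.

Lemma geo_le (a b c : R) : (forall n, a <= b + c / 2 ^+ n) -> a <= b.
Proof.
move=> h; apply/ler_addgt0Pl => e e0.
have [c0|c0] := leP c 0.
  have := h 0%N; rewrite expr0 divr1; lra.
have [n hn] : exists n : nat, c / e < n%:R.
  by exists (Num.bound (c / e)); apply: archi_boundP; rewrite divr_ge0 ?ltW.
apply: (le_trans (h n)); rewrite addrC lerD2r.
rewrite ler_pdivrMr ?exprn_gt0 // mulrC -ler_pdivrMr //.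
apply: ltW; apply: (lt_le_trans hn); rewrite -natrX ler_nat.
exact/ltnW/ltn_expl.
Qed.

(** The intervals of centre [a n] and radius [2 * c / 2 ^+ n] are nested. *)
Lemma geo_lim (a : nat -> R) c : (forall n, `|a n.+1 - a n| <= c / 2 ^+ n) ->
  exists l, forall n, `|l - a n| <= 2 * c / 2 ^+ n.
Proof.
move=> h; pose d n : R := 2 * c / 2 ^+ n.
have dS n : d n = c / 2 ^+ n + d n.+1.
  rewrite /d exprS; have : (2 ^+ n : R) != 0 by rewrite expf_neq0.
  by move=> ?; field.
have up m n : (m <= n)%N -> a m - d m <= a n - d n /\ a n + d n <= a m + d m.
  elim: n => [|n IH]; first by rewrite leqn0 => /eqP ->.
  rewrite leq_eqVlt => /orP[/eqP ->//|/IH [h1 h2]].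
  by have := h n; rewrite ler_norml => /andP[]; have := dS n; split; lra.
have d0 n : 0 <= d n.
  have c0 : 0 <= c by have := le_trans (normr_ge0 _) (h 0%N); rewrite expr0 divr1.
  by rewrite divr_ge0 ?exprn_ge0 // mulr_ge0.
have ub n : ubound (range (fun m => a m - d m)) (a n + d n).
  move=> _ [m _ <-]; have [mn|/ltnW nm] := leqP m n.
    by have [? ?] := up _ _ mn; have := d0 n; lra.
  by have [? ?] := up _ _ nm; have := d0 m; lra.
have hs : has_sup (range (fun m => a m - d m)).
  by split; [exists (a 0%N - d 0%N); exists 0%N|exists (a 0%N + d 0%N); apply: ub].
exists (sup (range (fun m => a m - d m))) => n; rewrite -/(d n) ler_norml.
have : a n - d n <= sup (range (fun m => a m - d m)).
  by apply: sup_ubound; [case: hs|exists n].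
have : sup (range (fun m => a m - d m)) <= a n + d n.
  by apply: ge_sup; [case: hs|exact: ub].
move=> h1 h2; apply/andP; split; lra.
Qed.

(** The function [d] stands for a distance between the terms of a sequence whose
    steps are bounded by [c / 2 ^+ n]. *)
Lemma geo_far (d : nat -> nat -> R) c : (forall n, d n n = 0) ->
  (forall m n, d m.+1 n <= c / 2 ^+ m + d m n) ->
  forall n k, d (n + k)%N n <= 2 * c / 2 ^+ n - 2 * c / 2 ^+ (n + k).
Proof.
move=> d0 dS n; elim=> [|k IH]; first by rewrite addn0 d0 subrr.
rewrite addnS; apply: (le_trans (dS _ _)); apply: (le_trans (lerD (lexx _) IH)).
have k0 : (2 ^+ (n + k) : R) != 0 by rewrite expf_neq0.
have n0 : (2 ^+ n : R) != 0 by rewrite expf_neq0.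
rewrite le_eqVlt; apply/orP; left; apply/eqP; rewrite [2 ^+ _.+1]exprS; field.
by rewrite n0 k0.
Qed.

Lemma normc_le_ReIm z : normc z <= `|complex.Re z| + `|complex.Im z|.
Proof.
rewrite -lecR rmorphD /= -normC_normc {1}[z]complexE.
apply: (le_trans (ler_normD _ _)); rewrite normrM !normC_normc !normc_real.
by rewrite /normc /= expr0n /= add0r expr1n sqrtr1 mul1r.
Qed.

Lemma Re_le_normc z : `|complex.Re z| <= normc z.
Proof. by rewrite -lecR -normC_normc; exact: normc_ge_Re. Qed.

Lemma Im_le_normc z : `|complex.Im z| <= normc z.
Proof.
case: z => a b; rewrite /normc /= -sqrtr_sqr ler_wsqrtr // lerDr sqr_ge0 //.
Qed.

Lemma geo_limc (a : nat -> R[i]) c : (forall n, normc (a n.+1 - a n) <= c / 2 ^+ n) ->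
  exists l, forall n, normc (l - a n) <= 4 * c / 2 ^+ n.
Proof.
move=> h.
have [|lr hr] := @geo_lim (fun n => complex.Re (a n)) c.
  by move=> n; apply: le_trans (h n); rewrite -raddfB; exact: Re_le_normc.
have [|li hi] := @geo_lim (fun n => complex.Im (a n)) c.
  by move=> n; apply: le_trans (h n); rewrite -raddfB; exact: Im_le_normc.
exists (Complex lr li) => n; apply: (le_trans (normc_le_ReIm _)).
rewrite !raddfB /=; have := hr n; have := hi n.
set x := `|_|; set y := `|_|; move=> h1 h2.
have -> : 4 * c / 2 ^+ n = 2 * c / 2 ^+ n + 2 * c / 2 ^+ n.
  rewrite -mulrDl; congr (_ / _); ring.
by apply: lerD.
Qed.
End Modulus.

(** Completeness is required of geometric sequences only, with an unspecified
    constant in the rate of convergence; [banach_lim] recovers the sharp one.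
    The pair of a set and a real function fits operator algebras, which are
    sets of functions on which [opnorm] is a norm, while it is not a norm on
    the ambient space of all functions. *)
Record banach (R : realType) (V : lmodType R[i]) (A : set V) (N : V -> R) : Prop :=
  Banach {
  banach_0 : A 0;
  banach_lin : forall (a : R[i]) x y, A x -> A y -> A (a *: x + y);
  banach_tri : forall x y, A x -> A y -> N (x + y) <= N x + N y;
  banach_Z : forall (a : R[i]) x, A x -> N (a *: x) = normc a * N x;
  banach_eq0 : forall x, A x -> N x = 0 -> x = 0;
  banach_complete : forall u c, (forall n, A (u n)) ->
    (forall n, N (u n.+1 - u n) <= c / 2 ^+ n) ->
    exists2 x, A x & exists C, forall n, N (x - u n) <= C / 2 ^+ n
}.

Section BanachTheory.
Variables (R : realType) (V : lmodType R[i]) (A : set V) (N : V -> R).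
Hypothesis H : banach A N.

Lemma banachZ a x : A x -> A (a *: x).
Proof. by move=> Ax; rewrite -[_ *: _]addr0; apply: (banach_lin H) => //; apply: (banach_0 H). Qed.

Lemma banachD x y : A x -> A y -> A (x + y).
Proof. by move=> Ax Ay; rewrite -[x]scale1r; apply: (banach_lin H). Qed.

Lemma banachN x : A x -> A (- x).
Proof. by move=> Ax; rewrite -scaleN1r; apply: banachZ. Qed.

Lemma banachB x y : A x -> A y -> A (x - y).
Proof. by move=> Ax Ay; apply: banachD => //; apply: banachN. Qed.

Lemma banach_norm0 : N 0 = 0.
Proof. by rewrite -(scale0r 0) (banach_Z H) ?normc0 ?mul0r //; apply: (banach_0 H). Qed.

Lemma banach_normN x : A x -> N (- x) = N x.
Proof.
by move=> Ax; rewrite -scaleN1r (banach_Z H) // normcN normc1 mul1r.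
Qed.

Lemma banach_ge0 x : A x -> 0 <= N x.
Proof.
move=> Ax; have := banach_tri H Ax (banachN Ax).
rewrite subrr banach_norm0 banach_normN //; lra.
Qed.

Lemma banach_triB x y z : A x -> A y -> A z -> N (x - y) <= N (x - z) + N (z - y).
Proof.
move=> Ax Ay Az; have -> : x - y = (x - z) + (z - y) by rewrite addrA subrK.
by apply: (banach_tri H) => //; apply: banachB.
Qed.

Lemma banach_subC x y : A x -> A y -> N (x - y) = N (y - x).
Proof. by move=> Ax Ay; rewrite -opprB banach_normN //; apply: banachB. Qed.

Lemma banach_lim u c : (forall n, A (u n)) ->
    (forall n, N (u n.+1 - u n) <= c / 2 ^+ n) ->
    exists2 x, A x & forall n, N (x - u n) <= 2 * c / 2 ^+ n.
Proof.
move=> Au hu; have [x Ax [C hC]] := banach_complete H Au hu.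
exists x => // n; apply: (@geo_le _ _ _ `|C|) => m.
have [c0 n0] : 0 <= c /\ (2 ^+ n : R) != 0.
  split; last by rewrite expf_neq0.
  have := le_trans (banach_ge0 (banachB (Au 1%N) (Au 0%N))) (hu 0%N).
  by rewrite expr0 divr1.
have far := @geo_far _ (fun m n => N (u m - u n)) c _ _ n.
apply: (le_trans (banach_triB _ _ (Au (n + m)%N))) => //.
rewrite addrC; apply: lerD; last first.
  apply: (le_trans (hC _)); apply: (le_trans (ler_norm _)).
  rewrite normrM normfV (gtr0_norm (exprn_gt0 _ _)) // exprD invfM mulrA mulrAC.
  apply: ler_piMr; first by rewrite divr_ge0 ?exprn_ge0.
  by rewrite invf_le1 ?exprn_ege1 ?exprn_gt0 ?ler1n.
apply: le_trans (far _ _ m) _ => [i|i j|]; first by rewrite subrr banach_norm0.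
  by apply: (le_trans (banach_triB _ _ (Au i))) => //; rewrite lerD2r.
rewrite gerBl divr_ge0 ?exprn_ge0 ?mulr_ge0 //.
Qed.
End BanachTheory.

Section OpenMapping.
Variables (R : realType) (V W : lmodType R[i]).
Variables (A : set V) (NA : V -> R) (B : set W) (NB : W -> R).
Hypotheses (HA : banach A NA) (HB : banach B NB).
Variable Phi : V -> W.
Hypothesis Phi_in : forall x, A x -> B (Phi x).
Hypothesis Phi_lin : forall (a : R[i]) x y, A x -> A y ->
  Phi (a *: x + y) = a *: Phi x + Phi y.
Hypothesis Phi_onto : forall y, B y -> exists2 x, A x & Phi x = y.
Variable M : R.
Hypothesis Phi_bd : forall x, A x -> NB (Phi x) <= M * NA x.

Let Phi0 : Phi 0 = 0.
Proof.
have := Phi_lin 1 (banach_0 HA) (banach_0 HA); rewrite !scale1r addr0.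
by move=> e; apply: (addrI (Phi 0)); rewrite addr0 -e.
Qed.

Let PhiD x y : A x -> A y -> Phi (x + y) = Phi x + Phi y.
Proof. by move=> Ax Ay; rewrite -[x]scale1r Phi_lin // !scale1r. Qed.

Let PhiZ a x : A x -> Phi (a *: x) = a *: Phi x.
Proof. by move=> Ax; rewrite -[_ *: _]addr0 Phi_lin ?Phi0 ?addr0 //; apply: banach_0 HA. Qed.

Let PhiN x : A x -> Phi (- x) = - Phi x.
Proof. by move=> Ax; rewrite -scaleN1r PhiZ // scaleN1r. Qed.

Let PhiB x y : A x -> A y -> Phi (x - y) = Phi x - Phi y.
Proof.
by move=> Ax Ay; rewrite PhiD ?PhiN //; apply: (banachN HA).
Qed.

Let approx n y e := exists2 x, A x & NA x <= n /\ NB (y - Phi x) < e.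

(** This is the argument of Baire: if no image of a ball were somewhere dense,
    nested balls avoiding the image of the ball of radius [n] at step [n] would
    shrink to a point outside the range. *)
Lemma somewhere_dense : exists (n : R) (y0 : W) (r : R), [/\ B y0, 0 < r &
  forall y, B y -> NB (y - y0) < r -> forall e, 0 < e -> approx n y e].
Proof.
apply: contrapT => no.
have step (p : nat * (W * R)) : exists q : W * R, B p.2.1 -> 0 < p.2.2 ->
    [/\ B q.1, 0 < q.2, NB (q.1 - p.2.1) < p.2.2 / 2, q.2 <= p.2.2 / 4 &
        forall x, A x -> NA x <= p.1%:R -> 2 * q.2 <= NB (q.1 - Phi x)].
  case: p => n [y0 r] /=; have [By0|nBy0] := pselect (B y0); last by exists (0, 0).
  have [r0|r0] := ltP 0 r; last by exists (0, 0).
  apply: contrapT => none; apply: no; exists n%:R, y0, (r / 2).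
  split=> //; first by rewrite divr_gt0.
  move=> y By yr e e0; apply: contrapT => nappr; apply: none.
  exists (y, Num.min r e / 4) => /= _ _; split => //.
  - by rewrite divr_gt0 // lt_min r0.
  - by rewrite ler_pM2r ?invr_gt0 // ge_min lexx.
  move=> x Ax xn; rewrite leNgt; apply/negP => lt; apply: nappr; exists x => //.
  split=> //; apply: (lt_le_trans lt).
  have : Num.min r e <= e by rewrite ge_min lexx orbT.
  lra.
(* The pair [s n] is a centre and a radius. Step [n] passes to a smaller ball,
   whose centre is at least twice its radius away from the image of the ball of
   radius [n]. *)
have [f hf] := choice step.
pose s := fix s n : W * R := if n is n'.+1 then f (n', s n') else (0, 1).
have sB n : B (s n).1 /\ 0 < (s n).2.
  elim: n => [|n [h1 h2]] /=; first by split; [exact: banach_0 HB|].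
  by have [] := hf (n, s n) h1 h2.
have sP n := hf (n, s n) (sB n).1 (sB n).2.
have s2 n : (s n).2 <= 1 / 2 ^+ n.
  elim: n => [|n IH]; first by rewrite expr0 divr1.
  have [_ _ _ /= h _] := sP n; apply: (le_trans h).
  rewrite exprS invfM mulrA; have := (sB n).2; lra.
have geo n : NB ((s n.+1).1 - (s n).1) <= 1 / 2 ^+ n.
  have [_ _ /= /ltW h _ _] := sP n; apply: (le_trans h).
  by have := s2 n; have := (sB n).2; lra.
have [y By hy] := banach_lim HB (fun n => (sB n).1) geo.
have near m n : NB ((s (n + m)%N).1 - (s n).1) + (s (n + m)%N).2 <= (s n).2.
  elim: m => [|m IH]; first by rewrite addn0 subrr (banach_norm0 HB) add0r.
  have [_ _ /= h1 h2 _] := sP (n + m)%N.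
  have := banach_triB HB (sB (n + m).+1).1 (sB n).1 (sB (n + m)%N).1.
  have := (sB (n + m)%N).2; rewrite addnS /= => h3 h4; lra.
have ynear n : NB (y - (s n).1) <= (s n).2.
  apply: (@geo_le _ _ _ 2) => m.
  have := banach_triB HB By (sB n).1 (sB (n + m)%N).1.
  have := near m n; have := (sB (n + m)%N).2; have := hy (n + m)%N.
  have : 2 * 1 / 2 ^+ (n + m) <= 2 / 2 ^+ m :> R.
    rewrite mulr1 ler_pM2l // lef_pV2 ?posrE ?exprn_gt0 //.
    by rewrite ler_eXn2l ?ltr1n // leq_addl.
  by lra.
have [x Ax e] := Phi_onto By.
pose n := Num.bound (NA x); have xn : NA x <= n%:R.
  by apply/ltW/archi_boundP/(banach_ge0 HA).
have [_ _ _ _ /(_ x Ax xn) /= h] := sP n.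
have := ynear n.+1; rewrite /= (banach_subC HB) //; last exact: (sB n.+1).1.
by have := (sB n.+1).2 => /=; rewrite e in h; lra.
Qed.

(** Differences of two approximations near the centre [y0] approximate small
    vectors, and scaling reaches all of them. *)
Lemma densely_bounded : exists2 K : R, 0 <= K &
  forall y, B y -> forall e, 0 < e -> approx (K * NB y) y e.
Proof.
have [n [y0 [r [By0 r0 dense]]]] := somewhere_dense.
have n0 : 0 <= n.
  have [|x Ax [xn _]] := dense y0 By0 _ 1 ltr01.
    by rewrite subrr (banach_norm0 HB).
  by apply: le_trans xn; apply: (banach_ge0 HA Ax).
exists (4 * n / r); first by rewrite divr_ge0 ?mulr_ge0 // ltW.
move=> y By e e0.
have [y_eq0|yn0] := eqVneq (NB y) 0.
  exists 0; first exact: banach_0 HA.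
  by rewrite (banach_norm0 HA) y_eq0 mulr0 Phi0 subr0 y_eq0.
have y_gt0 : 0 < NB y by rewrite lt_def yn0 (banach_ge0 HB).
pose s := r / (2 * NB y); have s0 : 0 < s by rewrite divr_gt0 ?mulr_gt0.
have nZ (z : W) : B z -> NB ((s%:C)%C *: z) = s * NB z.
  by move=> Bz; rewrite (banach_Z HB) // normc_real gtr0_norm.
have se0 : 0 < s * e / 2 by apply: divr_gt0 => //; apply: mulr_gt0.
have Bz : B (y0 + (s%:C)%C *: y).
  apply: (banachD HB) => //. apply: (banachZ HB). exact: By.
have [||x1 Ax1 [x1n x1e]] := dense (y0 + (s%:C)%C *: y) _ _ _ se0 => //.
  rewrite addrAC subrr add0r nZ // /s.
  have -> : r / (2 * NB y) * NB y = r / 2 by field.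
  lra.
have [|x2 Ax2 [x2n x2e]] := dense y0 By0 _ _ se0 => //.
  by rewrite subrr (banach_norm0 HB).
have sC : (s%:C)%C != 0 :> R[i] by rewrite -[0]/((0 : R)%:C)%C (inj_eq (@complexI R)) gt_eqF.
have sV : normc ((s%:C)%C^-1) = s^-1 by rewrite normcV normc_real gtr0_norm.
have Ax12 := banachB HA Ax1 Ax2.
exists (((s%:C)%C)^-1 *: (x1 - x2)); first exact (banachZ HA _ Ax12).
split.
  rewrite (banach_Z HA) // sV ler_pdivrMl //.
  have -> : s * (4 * n / r * NB y) = n + n by rewrite /s; field; rewrite yn0 gt_eqF.
  apply: (le_trans (banach_tri HA Ax1 (banachN HA Ax2))).
  by rewrite (banach_normN HA) // lerD.
rewrite PhiZ // PhiB //.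
rewrite -(ltr_pM2l s0) -nZ; last first.
  apply: (banachB HB By); apply: (banachZ HB).
  exact: (banachB HB (Phi_in Ax1) (Phi_in Ax2)).
rewrite [_ *: (y - _)]scalerBr scalerA mulfV // scale1r.
have -> : (s%:C)%C *: y - (Phi x1 - Phi x2) =
  (y0 + (s%:C)%C *: y - Phi x1) + (Phi x2 - y0).
  by rewrite opprB [RHS]addrC -[y0 + _ - _]addrA [RHS]addrA subrK addrCA.
have B1 := banachB HB Bz (Phi_in Ax1).
have B2 := banachB HB (Phi_in Ax2) By0.
apply: (le_lt_trans (banach_tri HB B1 B2)).
rewrite (banach_subC HB (Phi_in Ax2)) //; lra.
Qed.

(** Successive approximation: each error is halved by [densely_bounded], and the
    corrections form a geometric series, whose sum lies in the complete [A]. *)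
Theorem open_mapping : exists K : R, forall y, B y ->
  exists2 x, A x & Phi x = y /\ NA x <= K * NB y.
Proof.
have [K K0 hK] := densely_bounded.
have step (p : W * R) : exists x, A x /\ (B p.1 -> 0 < p.2 ->
    NA x <= K * NB p.1 /\ NB (p.1 - Phi x) < p.2).
  have [Bp|nBp] := pselect (B p.1); last by exists 0; split; [exact: banach_0 HA|].
  have [e0|e0] := ltP 0 p.2; last by exists 0; split; [exact: banach_0 HA|].
  by have [x Ax h] := hK _ Bp _ e0; exists x.
have [f hf] := choice step.
exists (2 * K) => y By.
have [y_eq0|yn0] := eqVneq (NB y) 0.
  exists 0; first exact: banach_0 HA.
  by rewrite (banach_norm0 HA) y_eq0 mulr0 Phi0 (banach_eq0 HB By y_eq0).
set c := NB y; have c0 : 0 < c by rewrite lt_def yn0 (banach_ge0 HB).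
pose e n : R := c / 2 ^+ n.
have e0 n : 0 < e n by rewrite divr_gt0 ?exprn_gt0.
pose z := fix z n : W := if n is n'.+1 then z n' - Phi (f (z n', e n)) else y.
pose x n := f (z n, e n.+1).
have Ax n : A (x n) := (hf _).1.
have Bz n : B (z n).
  by elim: n => //= n IH; apply: (banachB HB) => //; apply/Phi_in/Ax.
have zP n := (hf (z n, e n.+1)).2 (Bz n) (e0 n.+1).
have ze n : NB (z n) <= e n.
  case: n => [|n]; first by rewrite /e expr0 divr1.
  by have [_ /ltW] := zP n.
pose u n := \sum_(i < n) x i.
have Au n : A (u n).
  elim: n => [|n IH]; first by rewrite /u big_ord0; exact: banach_0 HA.
  by rewrite /u big_ord_recr /=; apply: (banachD HA IH (Ax n)).
have uS n : u n.+1 - u n = x n by rewrite /u big_ord_recr /= addrAC subrr add0r.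
have zE n : z n = y - Phi (u n).
  elim: n => [|n IH] /=; first by rewrite /u big_ord0 Phi0 subr0.
  have -> : u n.+1 = u n + x n by rewrite /u big_ord_recr.
  by rewrite (PhiD (Au n) (Ax n)) opprD addrA -IH.
have [|x' Ax' hx'] := banach_lim HA (c := K * c) Au.
  move=> n; rewrite uS; have [h _] := zP n; apply: (le_trans h).
  by rewrite -mulrA; apply: (ler_wpM2l K0 (ze n)).
exists x' => //; split; last first.
  have := hx' 0%N; rewrite /u big_ord0 subr0 expr0 divr1; lra.
have M0 : 0 <= `|M| by [].
have ge n : 0 <= NB (Phi x' - y) <= 0 + (`|M| * (2 * (K * c)) + c) / 2 ^+ n.
  have By' := Phi_in Ax'; rewrite (banach_ge0 HB) ?add0r; last exact: (banachB HB).
  apply: (le_trans (banach_triB HB By' By (Phi_in (Au n)))).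
  rewrite mulrDl; apply: lerD; last first.
    by rewrite (banach_subC HB) -?zE //; apply: Phi_in.
  rewrite -PhiB //; have Ad := banachB HA Ax' (Au n).
  apply: (le_trans (Phi_bd Ad)); rewrite -mulrA.
  apply: le_trans (ler_wpM2l M0 (hx' n)).
  by rewrite ler_wpM2r ?ler_norm // (banach_ge0 HA).
apply/eqP; rewrite -subr_eq0; apply/eqP; apply: (banach_eq0 HB).
  by apply: (banachB HB) => //; apply: Phi_in.
apply/eqP; rewrite eq_le; have /andP[-> _] := ge 0%N; rewrite andbT.
by apply: (@geo_le _ _ _ (`|M| * (2 * (K * c)) + c)) => n; have /andP[] := ge n.
Qed.
End OpenMapping.

(** * Hilbert spaces and Parseval frames *)

Section Hilbert.
Variable R : realType.
Implicit Types (H K : hilbert R).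

Definition hnorm H (v : H) : R := Num.sqrt (sqnorm v).

Lemma hnorm_ge0 H (v : H) : 0 <= hnorm v.
Proof. exact: sqrtr_ge0. Qed.

Lemma hnorm_sq H (v : H) : hnorm v ^+ 2 = sqnorm v.
Proof. by rewrite sqr_sqrtr ?sqnorm_ge0. Qed.

Lemma hdotZl H a (u v : H) : hdot H (a *: u) v = a * hdot H u v.
Proof. exact: linearZl_LR. Qed.

Lemma hdotZr H a (u v : H) : hdot H u (a *: v) = a^* * hdot H u v.
Proof. exact: linearZr_LR. Qed.

Lemma hdotDl H (u v w : H) : hdot H (u + v) w = hdot H u w + hdot H v w.
Proof. exact: linearDl. Qed.

Lemma hdotBl H (u v w : H) : hdot H (u - v) w = hdot H u w - hdot H v w.
Proof. exact: linearBl. Qed.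

Lemma hdot0l H (v : H) : hdot H 0 v = 0.
Proof. exact: linear0l. Qed.

Lemma hdotC H (u v : H) : hdot H u v = (hdot H v u)^*.
Proof. by have := hermC (hdot H) u v; rewrite expr0 mul1r. Qed.

Lemma hdot_suml H (I : Type) (r : seq I) (P : pred I) (f : I -> H) v :
  hdot H (\sum_(i <- r | P i) f i) v = \sum_(i <- r | P i) hdot H (f i) v.
Proof.
by elim/big_rec2: _ => [|i x y _ <-]; [exact: hdot0l|exact: hdotDl].
Qed.

Lemma hdotvv H (v : H) : hdot H v v = ((sqnorm v)%:C)%C.
Proof.
rewrite /sqnorm RRe_real //; apply: ger0_real; exact: (dnorm_ge0 (hdot H)).
Qed.

Lemma Cauchy_Schwarz H (u v : H) : normc (hdot H u v) <= hnorm u * hnorm v.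
Proof.
rewrite -(@ler_pXn2r _ 2) ?nnegrE ?normc_ge0 ?mulr_ge0 ?hnorm_ge0 //.
rewrite exprMn !hnorm_sq -lecR rmorphXn rmorphM /= -normC_normc -!hdotvv.
by have [] := CauchySchwarz (hdot H) u v.
Qed.

Lemma sqnorm_Z H (a : R[i]) (v : H) : sqnorm (a *: v) = normc a ^+ 2 * sqnorm v.
Proof. by rewrite sqnormZ normC_normc -rmorphXn. Qed.

(** The weight makes this inequality summable over the fibres: with
    [sqrt_le_add] it gives the triangle inequality in the Fock space without
    the inequality of Cauchy and Schwarz for series. *)
Lemma sqnormD_weighted H (u v : H) (t : R) : 0 < t ->
  sqnorm (u + v) <= (1 + t) * sqnorm u + (1 + t^-1) * sqnorm v.
Proof.
move=> t0; pose a := Num.sqrt t; have a0 : a != 0 by rewrite sqrtr_eq0 -ltNge.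
have a2 : a ^+ 2 = t by rewrite sqr_sqrtr // ltW.
have key : sqnorm (u + v) + sqnorm ((a%:C)%C *: u - (a^-1%:C)%C *: v) =
    (1 + t) * sqnorm u + (1 + t^-1) * sqnorm v.
  have dZ (x y : R) : hdot H ((x%:C)%C *: u) ((y%:C)%C *: v) =
      ((x * y)%:C)%C * hdot H u v.
    by rewrite hdotZl hdotZr conj_Creal ?complex_real // rmorphM mulrA.
  rewrite /sqnorm dnormD dnormB dZ mulfV // mul1r !raddfD !raddfN /=.
  rewrite -!/(sqnorm _) !sqnorm_Z !normc_real !real_normK ?num_real //.
  rewrite exprVn a2; ring.
by rewrite -key lerDl sqnorm_ge0.
Qed.

Lemma sqrt_le_add (a b s : R) : 0 <= a -> 0 <= b ->
  (forall t, 0 < t -> s <= (1 + t) * a + (1 + t^-1) * b) ->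
  Num.sqrt s <= Num.sqrt a + Num.sqrt b.
Proof.
move=> a0 b0 h; apply/ler_addgt0Pl => e e0.
pose x := Num.sqrt a + e / 2; pose y := Num.sqrt b + e / 2.
have x0 : 0 < x by rewrite ltr_wpDl ?sqrtr_ge0 ?divr_gt0.
have y0 : 0 < y by rewrite ltr_wpDl ?sqrtr_ge0 ?divr_gt0.
have ax : a <= x ^+ 2.
  by rewrite -[a]sqr_sqrtr // ler_pXn2r ?nnegrE ?sqrtr_ge0 ?ltW // /x; lra.
have by_ : b <= y ^+ 2.
  by rewrite -[b]sqr_sqrtr // ler_pXn2r ?nnegrE ?sqrtr_ge0 ?ltW // /y; lra.
have -> : e + (Num.sqrt a + Num.sqrt b) = x + y by rewrite /x /y; field.
have -> : x + y = Num.sqrt ((x + y) ^+ 2).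
  by rewrite sqrtr_sqr ger0_norm // addr_ge0 ?ltW.
rewrite ler_wsqrtr //.
(* This weight is the optimal one for [x ^+ 2] and [y ^+ 2] in place of [a] and
   [b]. *)
apply: (le_trans (h (y / x) _)); first by rewrite divr_gt0.
have -> : (x + y) ^+ 2 = (1 + y / x) * x ^+ 2 + (1 + (y / x)^-1) * y ^+ 2.
  by field; rewrite !gt_eqF.
by apply: lerD; apply: ler_wpM2l => //; rewrite addr_ge0 // ?invr_ge0 divr_ge0 ?ltW.
Qed.

Lemma hnorm_tri H (u v : H) : hnorm (u + v) <= hnorm u + hnorm v.
Proof. by apply: sqrt_le_add => [||t]; rewrite ?sqnorm_ge0 //; apply: sqnormD_weighted. Qed.

Lemma hnorm_Z H a (v : H) : hnorm (a *: v) = normc a * hnorm v.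
Proof.
by rewrite /hnorm sqnorm_Z sqrtrM ?exprn_even_ge0 // sqrtr_sqr ger0_norm ?normc_ge0.
Qed.

Lemma hnorm_eq0 H (v : H) : hnorm v = 0 -> v = 0.
Proof.
move=> e; apply/eqP; rewrite -(dnorm_eq0 (hdot H)) hdotvv -hnorm_sq e expr0n.
by rewrite /= eqxx.
Qed.

Lemma hnorm_sum H (I : Type) (r : seq I) (P : pred I) (f : I -> H) :
  hnorm (\sum_(i <- r | P i) f i) <= \sum_(i <- r | P i) hnorm (f i).
Proof.
elim/big_rec2: _ => [|i y x _ h]; first by rewrite /hnorm sqnorm0 sqrtr0.
by apply: (le_trans (hnorm_tri _ _)); rewrite lerD2l.
Qed.

(** [g \o f] is an orthogonal projection, and [f] is isometric on its range. *)
Lemma coisometry_le H K (f : 'Hom(H, K)) x : coisometry f -> sqnorm (f x) <= sqnorm x.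
Proof.
case=> g adj gK; have -> : sqnorm x = sqnorm ((x - g (f x)) + g (f x)) by rewrite subrK.
rewrite {2}/sqnorm dnormD.
have -> : hdot H (x - g (f x)) (g (f x)) = 0.
  by rewrite -adj linearB /= gK subrr hdot0l.
rewrite conjC0 !addr0 -adj gK raddfD /= -!/(sqnorm _).
by rewrite lerDr sqnorm_ge0.
Qed.

Lemma sqnorm_tens H K (T : tensor H K) a b :
  sqnorm (tens T a b) = sqnorm a * sqnorm b.
Proof. by apply: complexI; rewrite -hdotvv tens_dot !hdotvv rmorphM. Qed.

(** The expansion property of orthonormal bases, without independence: unlike
    orthonormality, it is inherited by images under coisometries, hence by the
    words in a subproduct system. *)
Definition parseval H (I : finType) (v : I -> H) : Prop :=
  forall x, x = \sum_i hdot H x (v i) *: v i.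

Lemma onb_dot H n (b : n.-tuple H) : orthonormal_basis b ->
  forall i j, hdot H (tnth b i) (tnth b j) = (i == j)%:R.
Proof.
case=> /orthonormalP[ub ob] _ i j.
by apply: (etrans (ob _ _ (mem_tnth _ _) (mem_tnth _ _))); rewrite (inj_eq (tuple_uniqP _ ub)).
Qed.

Lemma onb_parseval H n (b : n.-tuple H) :
  orthonormal_basis b -> parseval (tnth b).
Proof.
move=> ob x; have bx : x \in <<b>>%VS by rewrite ob.2 memvf.
rewrite {1}(coord_span bx); apply: eq_bigr => i _; rewrite -tnth_nth; congr (_ *: _).
rewrite {2}(coord_span bx) hdot_suml (bigD1 i) //= big1 ?addr0.
  by rewrite hdotZl -!tnth_nth onb_dot // eqxx mulr1.
by move=> j ji; rewrite hdotZl -!tnth_nth onb_dot // (negPf ji) mulr0.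
Qed.

Lemma tens_parseval H K (T : tensor H K) (I J : finType) (v : I -> H) (w : J -> K) :
  parseval v -> parseval w -> parseval (fun p : I * J => tens T (v p.1) (w p.2)).
Proof.
move=> pv pw x.
(* The defect of the expansion is linear and vanishes on elementary tensors. *)
pose f : T -> T := fun x => x - \sum_(p : I * J) hdot T x (tens T (v p.1) (w p.2)) *: tens T (v p.1) (w p.2).
have flin : linear f.
  move=> a y z; rewrite /f scalerBr scaler_sumr addrACA -opprD -big_split /=.
  congr (_ - _); apply: eq_bigr => p _.
  by rewrite hdotDl hdotZl scalerDl scalerA.
pose F : {linear T -> T} := HB.pack f (GRing.isLinear.Build _ _ _ _ f flin).
have ker : lker (linfun F) = fullv.
  apply: (@tens_span _ _ _ T) => a b; rewrite memv_ker lfunE /= /f subr_eq0.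
  have e : tens T a b = \sum_(p : I * J) (hdot H a (v p.1) * hdot K b (w p.2)) *: tens T (v p.1) (w p.2).
    have tl := tens_linl T; have tr := tens_linr T.
    pose ta b : {linear H -> T} := HB.pack ((tens T)^~ b) (GRing.isLinear.Build _ _ _ _ _ (tl b)).
    pose tb a : {linear K -> T} := HB.pack (tens T a) (GRing.isLinear.Build _ _ _ _ _ (tr a)).
    rewrite -(pair_bigA _ (fun i j => (hdot H a (v i) * hdot K b (w j)) *: tens T (v i) (w j))) /=.
    rewrite {1}(pv a) -[LHS]/(ta b _) linear_sum; apply: eq_bigr => i _.
    rewrite linearZ /= {1}(pw b) -[tens T _ _]/(tb (v i) _) linear_sum scaler_sumr.
    by apply: eq_bigr => j _; rewrite linearZ /= scalerA.
  by rewrite {1}e; apply/eqP/eq_bigr => p _; rewrite tens_dot.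
have : x \in lker (linfun F) by rewrite ker memvf.
by rewrite memv_ker lfunE /= /f subr_eq0 => /eqP.
Qed.

Lemma coisometry_parseval H K (f : 'Hom(H, K)) (I : finType) (v : I -> H) :
  coisometry f -> parseval v -> parseval (f \o v).
Proof.
case=> g adj gK pv y; rewrite -{1}[y]gK {1}(pv (g y)) linear_sum /=.
apply: eq_bigr => i _; rewrite linearZ /=; congr (_ *: _).
by rewrite hdotC [RHS]hdotC adj.
Qed.

Lemma parseval_banach H (I : finType) (v : I -> H) : parseval v ->
  banach setT (@hnorm H).
Proof.
move=> pv; split=> //; first by move=> x y _ _; apply: hnorm_tri.
- by move=> a x _; apply: hnorm_Z.
- by move=> x _; apply: hnorm_eq0.
move=> u c _ hu.
have co i : exists l : R[i], forall n,
    normc (l - hdot H (u n) (v i)) <= 4 * (c * hnorm (v i)) / 2 ^+ n.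
  apply: geo_limc => n; rewrite -hdotBl; apply: (le_trans (Cauchy_Schwarz _ _)).
  by rewrite mulrAC ler_wpM2r ?hnorm_ge0.
have [l hl] := choice co.
exists (\sum_i l i *: v i) => //.
exists (\sum_i 4 * (c * hnorm (v i)) * hnorm (v i)) => n.
rewrite {1}(pv (u n)) -sumrB mulr_suml; apply: (le_trans (hnorm_sum _ _ _)).
apply: ler_sum => i _; rewrite -scalerBl hnorm_Z mulrAC.
by rewrite ler_wpM2r ?hnorm_ge0.
Qed.

End Hilbert.

(** * The Fock space *)

Section Esum.
Variables (R : realType) (I : choiceType) (f : I -> R).

Lemma esum_le_seq K : (forall r, uniq r -> \sum_(i <- r) f i <= K) ->
  (\esum_(i in [set: I]) (f i)%:E <= K%:E)%E.
Proof.
move=> h; apply: ge_ereal_sup => _ [A [Afin _] <-].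
rewrite fsbig_finite //= sumEFin lee_fin; apply: h; exact: finmap.fset_uniq.
Qed.

Lemma seq_le_esum r : uniq r ->
  ((\sum_(i <- r) f i)%:E <= \esum_(i in [set: I]) (f i)%:E)%E.
Proof.
move=> ur; apply: ereal_sup_ubound; exists [set` r]; first by split; [exact: finite_seq|].
by rewrite -sumEFin -fsbig_seq.
Qed.
End Esum.

Section Fock.
Variables (R : realType) (X : subproduct_system R).
Implicit Types (xi zeta : fock X).

Lemma square_summable_seq (x : forall s, X s) K :
  (forall r, uniq r -> \sum_(s <- r) sqnorm (x s) <= K) -> square_summable x.
Proof.
by move=> h; apply: le_lt_trans (ltry K); apply: esum_le_seq.
Qed.

Lemma fnorm_sqE xi :
  ((fnorm xi ^+ 2)%:E = \esum_(s in [set: nat * nat]) (sqnorm (fval xi s))%:E)%E.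
Proof.
have e0 : (0 <= \esum_(s in [set: nat * nat]) (sqnorm (fval xi s))%:E)%E.
  by apply: esum_ge0 => s _; rewrite lee_fin sqnorm_ge0.
rewrite /fnorm sqr_sqrtr ?fine_ge0 // fineK // ge0_fin_numE //; exact: fvalP.
Qed.

Lemma fnorm_ge0 xi : 0 <= fnorm xi.
Proof. exact: sqrtr_ge0. Qed.

Lemma seq_le_fnorm xi r : uniq r -> \sum_(s <- r) sqnorm (fval xi s) <= fnorm xi ^+ 2.
Proof. by move=> ur; rewrite -lee_fin fnorm_sqE; apply: seq_le_esum. Qed.

Lemma fnorm_le_seq xi K :
  (forall r, uniq r -> \sum_(s <- r) sqnorm (fval xi s) <= K) -> fnorm xi ^+ 2 <= K.
Proof. by move=> h; rewrite -lee_fin fnorm_sqE; apply: esum_le_seq. Qed.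

Lemma fnorm_le xi K : 0 <= K ->
  (forall r, uniq r -> \sum_(s <- r) sqnorm (fval xi s) <= K ^+ 2) -> fnorm xi <= K.
Proof.
by move=> K0 h; rewrite -(@ler_pXn2r _ 2) ?nnegrE ?fnorm_ge0 //; apply: fnorm_le_seq.
Qed.

Lemma hnorm_fval xi s : hnorm (fval xi s) <= fnorm xi.
Proof.
rewrite -(@ler_pXn2r _ 2) ?nnegrE ?fnorm_ge0 ?hnorm_ge0 // hnorm_sq.
by have := @seq_le_fnorm xi [:: s] isT; rewrite big_seq1.
Qed.

Lemma fnorm_tri xi zeta : fnorm (xi + zeta) <= fnorm xi + fnorm zeta.
Proof.
have e (x : fock X) : fnorm x = Num.sqrt (fnorm x ^+ 2).
  by rewrite sqrtr_sqr (ger0_norm (fnorm_ge0 x)).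
rewrite (e xi) (e zeta) (e (xi + zeta)); apply: sqrt_le_add; rewrite ?sqr_ge0 //.
move=> t t0; apply: fnorm_le_seq => r ur /=.
apply: (@le_trans _ _ (\sum_(s <- r) ((1 + t) * sqnorm (fval xi s) +
    (1 + t^-1) * sqnorm (fval zeta s)))).
  by apply: ler_sum => s _; apply: sqnormD_weighted.
rewrite big_split /= -!mulr_sumr; apply: lerD; apply: ler_wpM2l;
  by rewrite ?seq_le_fnorm ?addr_ge0 ?invr_ge0 ?ltW.
Qed.

Lemma fnorm_Z a xi : fnorm (a *: xi) = normc a * fnorm xi.
Proof.
have le b (x : fock X) : fnorm (b *: x) <= normc b * fnorm x.
  apply: fnorm_le => [|r ur]; first by rewrite mulr_ge0 ?fnorm_ge0 ?normc_ge0.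
  rewrite exprMn; apply: le_trans (ler_wpM2l (sqr_ge0 (normc b)) (seq_le_fnorm x ur)).
  by rewrite mulr_sumr; apply: ler_sum => s _ /=; rewrite sqnorm_Z.
apply/eqP; rewrite eq_le le /=; have [->|a0] := eqVneq a 0.
  by rewrite normc0 mul0r fnorm_ge0.
have na : 0 < normc a.
  by rewrite lt_def normc_ge0 andbT; apply: contra_neq a0 => /eq0_normc.
rewrite -ler_pdivlMl // -normcV.
by rewrite -{1}[xi]scale1r -(mulVf a0) -scalerA.
Qed.

Lemma fnorm_eq0 xi : fnorm xi = 0 -> xi = 0.
Proof.
move=> e; apply: fock_eq => s; apply: hnorm_eq0; apply/eqP.
by rewrite eq_le hnorm_ge0 andbT -e hnorm_fval.
Qed.

Lemma fval_sum (I : Type) (r : seq I) (f : I -> fock X) s :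
  fval (\sum_(i <- r) f i) s = \sum_(i <- r) fval (f i) s.
Proof. by elim/big_rec2: _ => //= i x y _ <-. Qed.

Lemma fval_incl s (a : X s) : fval (incl a) s = a.
Proof. exact: dfwith_in. Qed.

Lemma fval_incl0 s t (a : X s) : s != t -> fval (incl a) t = 0.
Proof. by move=> st; apply: dfwith_out; rewrite // eq_sym. Qed.

Lemma incl_lin s (a : R[i]) (x y : X s) : incl (a *: x + y) = a *: incl x + incl y.
Proof.
apply: fock_eq => t /=; have [<-|st] := eqVneq s t; first by rewrite !dfwith_in.
by rewrite !dfwith_out ?scaler0 ?addr0 //.
Qed.

Lemma incl0 s : incl (0 : X s) = 0.
Proof. by have := incl_lin (-1) (0 : X s) 0; rewrite !scaleN1r !addNr. Qed.

Lemma inclD s (x y : X s) : incl (x + y) = incl x + incl y.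
Proof. by have := incl_lin 1 x y; rewrite !scale1r. Qed.

Lemma inclZ s a (x : X s) : incl (a *: x) = a *: incl x.
Proof. by have := incl_lin a x 0; rewrite incl0 !addr0. Qed.

Lemma incl_sum s (I : Type) (r : seq I) (P : pred I) (f : I -> X s) :
  incl (\sum_(i <- r | P i) f i) = \sum_(i <- r | P i) incl (f i).
Proof. by elim/big_rec2: _ => [|i x y _ <-]; rewrite ?incl0 ?inclD. Qed.

Lemma incl_ecast s t (q : s = t) (a : X s) : incl (ecast q (X q) q a) = incl a.
Proof. by case: _ / q. Qed.

(** Otherwise every finite partial sum of the squared norm would stay below the
    total by [e ^+ 2], and so would their supremum. *)
Lemma fock_dense xi (e : R) : 0 < e ->
  exists r, fnorm (xi - \sum_(s <- r) incl (fval xi s)) < e.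
Proof.
move=> e0; apply: contrapT => no.
have : fnorm xi ^+ 2 <= fnorm xi ^+ 2 - e ^+ 2; last first.
  by have := exprn_gt0 2 e0; lra.
apply: fnorm_le_seq => r ur.
have cut t : fval (xi - \sum_(s <- r) incl (fval xi s)) t =
    if t \in r then 0 else fval xi t.
  rewrite /= fval_sum; case: ifPn => tr.
    rewrite (bigD1_seq t) // fval_incl big1 /= ?addr0 ?subrr // => s st.
    exact: fval_incl0.
  rewrite big_seq big1 ?subr0 // => s sr.
  by apply: fval_incl0; apply: contraNneq tr => <-.
rewrite lerBrDr -lerBrDl; apply: (@le_trans _ _ (fnorm (xi - \sum_(s <- r) incl (fval xi s)) ^+ 2)).
  rewrite ler_pXn2r ?nnegrE ?fnorm_ge0 ?(ltW e0) //; rewrite leNgt; apply/negP => lt.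
  by apply: no; exists r.
apply: fnorm_le_seq => q uq; rewrite lerBrDl.
pose q' := [seq t <- q | t \notin r].
have -> : \sum_(t <- q) sqnorm (fval (xi - \sum_(s <- r) incl (fval xi s)) t) =
    \sum_(t <- q') sqnorm (fval xi t).
  rewrite big_filter [RHS]big_mkcond; apply: eq_bigr => t _.
  by rewrite cut; case: (t \in r); rewrite ?sqnorm0.
rewrite -big_cat; apply: seq_le_fnorm.
rewrite cat_uniq ur filter_uniq // andbT; apply/hasPn => t.
by rewrite mem_filter => /andP[].
Qed.

(** The limit is taken in each fibre; finite partial sums of its distance to
    [u n] are limits of those of [u (n + k)], which are uniformly bounded. *)
Lemma fock_banach : (forall s, banach setT (@hnorm _ (X s))) ->
  banach setT (@fnorm _ X).
Proof.
move=> fib; split=> //.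
- by move=> x y _ _; apply: fnorm_tri.
- by move=> a x _; apply: fnorm_Z.
- by move=> x _; apply: fnorm_eq0.
move=> u c _ hu.
have lim s : exists x : X s, forall n, hnorm (x - fval (u n) s) <= 2 * c / 2 ^+ n.
  have [||x _ hx] := @banach_lim _ _ _ _ (fib s) (fun n => fval (u n) s) c => //.
    by move=> n; apply: le_trans (hu n); apply: (hnorm_fval (u n.+1 - u n) s).
  by exists x.
pose x s := projT1 (cid (lim s)).
have hx s n : hnorm (x s - fval (u n) s) <= 2 * c / 2 ^+ n := projT2 (cid (lim s)) n.
have c0 : 0 <= c by have := le_trans (fnorm_ge0 _) (hu 0%N); rewrite expr0 divr1.
have far n k : fnorm (u (n + k)%N - u n) <= 2 * c / 2 ^+ n.
  have far := @geo_far _ (fun m n => fnorm (u m - u n)) c _ _ n k.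
  apply: (le_trans (far _ _)) => [i|i j|].
  - by rewrite subrr -(scale0r 0) fnorm_Z normc0 mul0r.
  - have -> : u i.+1 - u j = (u i.+1 - u i) + (u i - u j) by rewrite addrA subrK.
    by apply: (le_trans (fnorm_tri _ _)); rewrite lerD2r.
  by rewrite gerBl divr_ge0 ?exprn_ge0 ?mulr_ge0.
have bound n r : uniq r ->
    \sum_(s <- r) sqnorm (x s - fval (u n) s) <= 2 * (2 * c / 2 ^+ n) ^+ 2.
  move=> ur; apply: (@geo_le _ _ _ (2 * \sum_(s <- r) (2 * c) ^+ 2)) => k.
  apply: (@le_trans _ _ (\sum_(s <- r) (2 * sqnorm (fval (u (n + k)%N - u n) s) +
     2 * ((2 * c) ^+ 2 / 2 ^+ k)))).
    apply: ler_sum => s _.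
    have -> : x s - fval (u n) s = (fval (u (n + k)%N - u n) s) + (x s - fval (u (n + k)%N) s).
      by rewrite /= [RHS]addrC [RHS]addrA subrK.
    apply: (le_trans (sqnormD_le _ _)); rewrite mulrDr lerD2l ler_pM2l //.
    rewrite -hnorm_sq; apply: (@le_trans _ _ ((2 * c / 2 ^+ (n + k)) ^+ 2)).
      by rewrite ler_pXn2r ?nnegrE ?hnorm_ge0 // divr_ge0 ?exprn_ge0 ?mulr_ge0.
    rewrite expr_div_n ler_wpM2l ?sqr_ge0 // lef_pV2 ?posrE ?exprn_gt0 //.
    by rewrite -exprM ler_eXn2l ?ltr1n // muln2 -addnn; apply: leq_trans (leq_addr _ _); apply: leq_addl.
  rewrite big_split /=; apply: lerD; rewrite -mulr_sumr.
    rewrite ler_pM2l //; apply: (le_trans (seq_le_fnorm (u (n + k)%N - u n) ur)).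
    by rewrite ler_pXn2r ?nnegrE ?fnorm_ge0 ?far // divr_ge0 ?exprn_ge0 ?mulr_ge0.
  by rewrite -mulr_suml mulrA.
pose z n : fock X := Fock (square_summable_seq (bound n)).
exists (z 0%N + u 0%N) => //; exists (2 * (2 * c)) => n.
have -> : z 0%N + u 0%N - u n = z n by apply: fock_eq => s /=; rewrite subrK.
rewrite -[2 * _ / _]mulrA; apply: fnorm_le => [|r ur].
  by rewrite mulr_ge0 // divr_ge0 ?exprn_ge0 ?mulr_ge0.
apply: (le_trans (bound n r ur)); rewrite [X in _ <= X]exprMn ler_wpM2r ?sqr_ge0 //.
by rewrite expr2; lra.
Qed.
End Fock.

(** * Bounded operators and closed subalgebras *)

Lemma geo_small (R : realType) (c e : R) : 0 < e -> exists n, c / 2 ^+ n < e.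
Proof.
move=> e0; apply: contrapT => no; suff : e <= 0 by rewrite leNgt e0.
apply: (@geo_le _ _ _ c) => n; rewrite add0r leNgt; apply/negP => lt.
by apply: no; exists n.
Qed.

Section Operators.
Variables (R : realType) (X : subproduct_system R).
Implicit Types (S T : fock X -> fock X) (xi zeta : fock X) (A : set (fock X -> fock X)).

Lemma fnorm0 : fnorm (0 : fock X) = 0.
Proof. by rewrite -(scale0r 0) fnorm_Z normc0 mul0r. Qed.

Lemma fnormN xi : fnorm (- xi) = fnorm xi.
Proof. by rewrite -scaleN1r fnorm_Z normcN normc1 mul1r. Qed.

Lemma opnorm_le T M : 0 <= M -> (forall xi, fnorm (T xi) <= M * fnorm xi) -> opnorm T <= M.
Proof.
move=> M0 h; apply: ge_sup.
  by exists (fnorm (T 0)); exists 0 => //=; rewrite fnorm0.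
move=> _ [xi /= x1 <-]; apply: (le_trans (h xi)).
by rewrite -[leRHS]mulr1 ler_wpM2l.
Qed.

Lemma bounded_operator_ge0 T : bounded_operator T ->
  exists2 M : R, 0 <= M & forall xi, fnorm (T xi) <= M * fnorm xi.
Proof.
case=> _ [M h]; exists `|M| => // xi; apply: (le_trans (h xi)).
by rewrite ler_wpM2r ?fnorm_ge0 ?ler_norm.
Qed.

Lemma bounded_linP T a xi zeta : bounded_operator T ->
  T (a *: xi + zeta) = a *: T xi + T zeta.
Proof. by case=> + _; apply. Qed.

Lemma bounded_op0 T : bounded_operator T -> T 0 = 0.
Proof.
move=> bT; have := bounded_linP (-1) 0 0 bT.
by rewrite !scaleN1r !addNr.
Qed.

Lemma bounded_opZ T a xi : bounded_operator T -> T (a *: xi) = a *: T xi.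
Proof. by move=> bT; rewrite -[a *: xi]addr0 bounded_linP // bounded_op0 ?addr0. Qed.

Lemma opnorm_bound T xi : bounded_operator T -> fnorm (T xi) <= opnorm T * fnorm xi.
Proof.
move=> bT; have [M M0 h] := bounded_operator_ge0 bT.
have [x0|xn0] := eqVneq (fnorm xi) 0.
  by rewrite (fnorm_eq0 x0) bounded_op0 // !fnorm0 mulr0.
have x_gt0 : 0 < fnorm xi by rewrite lt_def xn0 fnorm_ge0.
rewrite -ler_pdivrMr //.
pose a : R[i] := (((fnorm xi)^-1)%:C)%C.
have na : normc a = (fnorm xi)^-1 by rewrite normc_real ger0_norm // invr_ge0 ltW.
have -> : fnorm (T xi) / fnorm xi = fnorm (T (a *: xi)).
  by rewrite bounded_opZ // fnorm_Z na mulrC.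
apply: ub_le_sup; last by exists (a *: xi) => //=; rewrite fnorm_Z na mulVf.
exists M => _ [zeta /= z1 <-]; apply: (le_trans (h zeta)).
by rewrite -[leRHS]mulr1 ler_wpM2l.
Qed.

Lemma opnorm_ge0 T : bounded_operator T -> 0 <= opnorm T.
Proof.
move=> bT; have [M M0 h] := bounded_operator_ge0 bT.
apply: (@le_trans _ _ (fnorm (T 0))); first exact: fnorm_ge0.
apply: ub_le_sup; last by exists 0 => //=; rewrite fnorm0.
exists M => _ [zeta /= z1 <-]; apply: (le_trans (h zeta)).
by rewrite -[leRHS]mulr1 ler_wpM2l.
Qed.

Lemma bounded_operator0 : bounded_operator (0 : fock X -> fock X).
Proof.
split; first by move=> a x y; rewrite /= scaler0 addr0.
by exists 0 => xi; rewrite mul0r fnorm0.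
Qed.

Lemma bounded_operator_id : bounded_operator (@id (fock X)).
Proof. by split=> //; exists 1 => xi; rewrite mul1r. Qed.

Lemma bounded_operator_lin a S T :
  bounded_operator S -> bounded_operator T -> bounded_operator (a *: S + T).
Proof.
move=> bS bT; have E z : (a *: S + T) z = a *: S z + T z by [].
split.
  move=> b x y; rewrite !E (bounded_linP b x y bS) (bounded_linP b x y bT).
  by rewrite !scalerDr !scalerA [b * a]mulrC addrACA.
exists (normc a * opnorm S + opnorm T) => xi; rewrite E.
apply: (le_trans (fnorm_tri _ _)); rewrite fnorm_Z mulrDl -mulrA.
by apply: lerD; [apply: ler_wpM2l; rewrite ?normc_ge0|]; rewrite ?opnorm_bound.
Qed.

Lemma bounded_operator_comp S T :
  bounded_operator S -> bounded_operator T -> bounded_operator (S \o T).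
Proof.
move=> bS bT; split; first by move=> b x y; rewrite /= !bounded_linP.
exists (opnorm S * opnorm T) => xi /=; apply: (le_trans (opnorm_bound _ bS)).
by rewrite -mulrA ler_wpM2l ?opnorm_ge0 ?opnorm_bound.
Qed.

Lemma bounded_operatorB S T :
  bounded_operator S -> bounded_operator T -> bounded_operator (S - T).
Proof.
move=> bS bT; have -> : S - T = -1 *: T + S by rewrite scaleN1r addrC.
exact: bounded_operator_lin.
Qed.

Lemma closed_subalgebra_bounded : closed_subalgebra (@bounded_operator R X).
Proof.
split=> //; [exact: bounded_operator0|exact: bounded_operator_lin|].
exact: bounded_operator_comp.
Qed.

Lemma closed_subalgebra_tensor : closed_subalgebra (tensor_algebra X).
Proof.
split.
- move=> T; apply; split; first exact: closed_subalgebra_bounded.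
  by move=> S [].
- by move=> A [[]].
- by move=> a S T hS hT A hA; have [[_ _ lin _ _] _] := hA; apply: lin; [apply: hS|apply: hT].
- by move=> S T hS hT A hA; have [[_ _ _ mul _] _] := hA; apply: mul; [apply: hS|apply: hT].
move=> T bT h A hA; have [[_ _ _ _ cl] _] := hA; apply: cl => // e e0.
by have [S hS lt] := h e e0; exists S => //; apply: hS.
Qed.

Lemma opnorm_tri S T : bounded_operator S -> bounded_operator T ->
  opnorm (S + T) <= opnorm S + opnorm T.
Proof.
move=> bS bT; apply: opnorm_le; first by rewrite addr_ge0 ?opnorm_ge0.
move=> xi; rewrite -[(S + T) xi]/(S xi + T xi) mulrDl; apply: (le_trans (fnorm_tri _ _)).
by rewrite lerD ?opnorm_bound.
Qed.

Lemma opnorm_Z a T : bounded_operator T -> opnorm (a *: T) = normc a * opnorm T.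
Proof.
have le b S : bounded_operator S -> opnorm (b *: S) <= normc b * opnorm S.
  move=> bS; apply: opnorm_le => [|xi]; first by rewrite mulr_ge0 ?normc_ge0 ?opnorm_ge0.
  by rewrite -[(b *: S) xi]/(b *: S xi) fnorm_Z -mulrA ler_wpM2l ?normc_ge0 ?opnorm_bound.
move=> bT; apply/eqP; rewrite eq_le le //=; have [->|a0] := eqVneq a 0.
  rewrite normc0 mul0r scale0r; exact: opnorm_ge0 bounded_operator0.
have na : 0 < normc a.
  by rewrite lt_def normc_ge0 andbT; apply: contra_neq a0 => /eq0_normc.
rewrite -ler_pdivlMl // -normcV -{1}[T]scale1r -(mulVf a0) -scalerA.
apply: le; rewrite -[a *: T]addr0; apply: bounded_operator_lin => //.
exact: bounded_operator0.
Qed.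

Lemma opnorm_eq0 T : bounded_operator T -> opnorm T = 0 -> T = 0.
Proof.
move=> bT e; apply/funext => xi; apply: fnorm_eq0; apply/eqP.
by rewrite eq_le fnorm_ge0 andbT -[leRHS](mul0r (fnorm xi)) -e opnorm_bound.
Qed.

(** The limit of the operators is their pointwise limit in the Fock space. *)
Lemma closed_subalgebra_banach A : banach setT (@fnorm R X) ->
  closed_subalgebra A -> banach A (@opnorm R X).
Proof.
move=> hF [Ab A0 Alin Amul Acl]; split=> //.
- by move=> S T /Ab bS /Ab bT; apply: opnorm_tri.
- by move=> a S /Ab; apply: opnorm_Z.
- by move=> S /Ab; apply: opnorm_eq0.
move=> u c Au hu.
have bu n := Ab _ (Au n).
have c0 : 0 <= c.
  by have := le_trans (opnorm_ge0 (bounded_operatorB (bu 1%N) (bu 0%N))) (hu 0%N); rewrite expr0 divr1.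
have lim xi : exists z, forall n, fnorm (z - u n xi) <= 2 * c * fnorm xi / 2 ^+ n.
  have [||z _ hz] := @banach_lim _ _ _ _ hF (fun n => u n xi) (c * fnorm xi) => //.
    move=> n; have := opnorm_bound xi (bounded_operatorB (bu n.+1) (bu n)).
    move=> h; apply: (le_trans h).
    rewrite -[leRHS]mulrA [fnorm xi / _]mulrC mulrA.
    exact (ler_wpM2r (fnorm_ge0 xi) (hu n)).
  by exists z => n; rewrite -(mulrA 2 c (fnorm xi)); exact: hz.
have [T hT] := choice lim.
have bT : bounded_operator T.
  split=> [a x y|]; last first.
    exists (2 * c + opnorm (u 0%N)) => xi; have := hT xi 0%N; rewrite expr0 divr1 => h.
    rewrite -[T xi](subrK (u 0%N xi)); apply: (le_trans (fnorm_tri _ _)).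
    by rewrite mulrDl; apply: lerD => //; apply: opnorm_bound.
  apply/eqP; rewrite -subr_eq0; apply/eqP/fnorm_eq0/eqP; rewrite eq_le fnorm_ge0 andbT.
  pose K := 2 * c * (fnorm (a *: x + y) + normc a * fnorm x + fnorm y).
  apply: (@geo_le _ _ _ K) => n; rewrite add0r.
  have -> : T (a *: x + y) - (a *: T x + T y) =
    (T (a *: x + y) - u n (a *: x + y)) + (- (a *: (T x - u n x)) - (T y - u n y)).
    rewrite (bounded_linP a x y (bu n)) [a *: (_ - _)]scalerBr.
    rewrite [- (a *: T x - _)]opprB [- (T y - _)]opprB [X in _ = _ + X]addrACA -[- (a *: T x) - T y]opprD.
    by rewrite [RHS]addrA subrK.
  apply: (le_trans (fnorm_tri _ _)); 
  have -> : K / 2 ^+ n = 2 * c * fnorm (a *: x + y) / 2 ^+ n +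
     (normc a * (2 * c * fnorm x / 2 ^+ n) + 2 * c * fnorm y / 2 ^+ n).
    by rewrite /K; move: (2 ^+ n)^-1 => v; ring.
  apply: lerD; first exact: hT.
  apply: (le_trans (fnorm_tri _ _)); rewrite !fnormN fnorm_Z.
  apply: lerD; last exact: hT.
  exact (ler_wpM2l (normc_ge0 a) (hT x n)).
have near n : opnorm (T - u n) <= 2 * c / 2 ^+ n.
  apply: opnorm_le => [|xi]; first by rewrite divr_ge0 ?exprn_ge0 ?mulr_ge0.
  by rewrite mulrAC; apply: hT.
exists T; last by exists (2 * c).
apply: Acl => // e e0; have [n hn] := geo_small (2 * c) e0.
by exists (u n) => //; apply: le_lt_trans hn.
Qed.

End Operators.

(** * Creation operators *)

Section Creation.
Variables (R : realType) (X : subproduct_system R).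
Implicit Types (xi zeta : fock X).

(** Bounded functionals are determined on vectors of finite support. *)
Lemma fock_functional_ext (phi : fock X -> R[i]) (C : R) :
  (forall a x y, phi (a *: x + y) = a * phi x + phi y) ->
  (forall xi, normc (phi xi) <= C * fnorm xi) ->
  (forall s (a : X s), phi (incl a) = 0) -> forall xi, phi xi = 0.
Proof.
move=> lin bd h xi.
have phi0 : phi 0 = 0.
  by have := lin (-1) 0 0; rewrite scaleN1r addNr mulN1r addNr.
have phiD x y : phi (x + y) = phi x + phi y by have := lin 1 x y; rewrite scale1r mul1r.
have phis (r : seq (nat * nat)) : phi (\sum_(s <- r) incl (fval xi s)) = 0.
  by elim: r => [|s r IH]; rewrite ?big_nil // big_cons phiD IH h addr0.
apply: eq0_normc; apply/eqP; rewrite eq_le normc_ge0 andbT.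
apply/ler_addgt0Pl => e e0; rewrite addr0.
have C1 : 0 < `|C| + 1 by rewrite ltr_wpDl.
have [r /ltW hr] := fock_dense xi (divr_gt0 e0 C1).
rewrite -[xi](subrK (\sum_(s <- r) incl (fval xi s))) phiD phis addr0.
apply: (le_trans (bd _)); rewrite ler_pdivlMr // in hr.
apply: le_trans hr; rewrite mulrC ler_wpM2l ?fnorm_ge0 //.
by rewrite (le_trans (ler_norm C)) // lerDl.
Qed.

Lemma bounded_operator_ext (S T : fock X -> fock X) :
  bounded_operator S -> bounded_operator T ->
  (forall s (a : X s), S (incl a) = T (incl a)) -> S = T.
Proof.
move=> bS bT h; have bD := bounded_operatorB bS bT.
apply/funext => xi; apply/eqP; rewrite -subr_eq0 -[S xi - T xi]/((S - T) xi).
apply/eqP/fock_eq => s; apply: hnorm_eq0.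
set v := fval _ s; pose phi zeta := hdot (X s) (fval ((S - T) zeta) s) v.
have phi0 : phi xi = 0.
  apply: (@fock_functional_ext phi (opnorm (S - T) * hnorm v)).
  - by move=> a x y; rewrite /phi bounded_linP //= hdotDl hdotZl.
  - move=> zeta; apply: (le_trans (Cauchy_Schwarz _ _)); rewrite mulrAC.
    by apply: ler_wpM2r; rewrite ?hnorm_ge0 // (le_trans (hnorm_fval _ _)) ?opnorm_bound.
  - by move=> t a; rewrite /phi -[(S - T) _]/(S _ - T _) h subrr /= hdot0l.
apply/eqP; rewrite -sqrf_eq0 hnorm_sq; apply/eqP/complexI.
by rewrite -hdotvv; exact: phi0.
Qed.

Lemma prodX_linl s t a (x y : X s) (b : X t) :
  prodX (a *: x + y) b = a *: prodX x b + prodX y b.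
Proof. by rewrite /prodX (tens_linl _ b a x y) linearP. Qed.

Lemma prodX_linr s t a (c : X s) (x y : X t) :
  prodX c (a *: x + y) = a *: prodX c x + prodX c y.
Proof. by rewrite /prodX (tens_linr _ c a x y) linearP. Qed.

Lemma prodX0r s t (c : X s) : prodX c (0 : X t) = 0.
Proof. by have := prodX_linr (-1) c (0 : X t) 0; rewrite !scaleN1r !addNr. Qed.

Lemma sqnorm_prodX s t (a : X s) (b : X t) : sqnorm (prodX a b) <= sqnorm a * sqnorm b.
Proof.
by rewrite -(sqnorm_tens (ftens X s t)); apply: coisometry_le; apply: Umap_coisometry.
Qed.

Lemma incl_prodXA s t r (a : X s) (b : X t) (c : X r) :
  incl (prodX a (prodX b c)) = incl (prodX (prodX a b) c).
Proof. by rewrite /prodX -Umap_assoc incl_ecast. Qed.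

Lemma incl_prodX_vac s (a : X s) : incl (prodX a (vac X)) = incl a.
Proof. by rewrite -[in RHS](Umap_s0 a) incl_ecast. Qed.

Lemma incl_vac_prodX s (a : X s) : incl (prodX (vac X) a) = incl a.
Proof. by rewrite -[in RHS](Umap_0s a) incl_ecast. Qed.

Definition psub (r s : nat * nat) : nat * nat := ((r.1 - s.1)%N, (r.2 - s.2)%N).

Lemma psubK (s t : nat * nat) : psub (s + t) s = t.
Proof. by case: s t => [a b] [c d]; rewrite /psub /= !addKn. Qed.

(** The component at [r] of the product of [eta] and [x]; the only summand is at
    [r - s], when [r] is above [s]. *)
Definition creation_comp s (eta : X s) (x : forall t, X t) (r : nat * nat) : X r :=
  match s + psub r s =P r with
  | ReflectT e => ecast q (X q) e (prodX eta (x (psub r s)))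
  | ReflectF _ => 0
  end.

Lemma creation_comp_add s (eta : X s) x t : creation_comp eta x (s + t) = prodX eta (x t).
Proof.
rewrite /creation_comp; case: eqP => [e|]; last by rewrite psubK.
move: e; rewrite psubK => e; by rewrite (eq_axiomK e).
Qed.

Lemma creation_comp_out s (eta : X s) x r : s + psub r s != r -> creation_comp eta x r = 0.
Proof. by rewrite /creation_comp; case: eqP. Qed.

Lemma creation_comp_lin s (eta : X s) a x y r :
  creation_comp eta (fun t => a *: x t + y t) r = a *: creation_comp eta x r + creation_comp eta y r.
Proof.
have [<-|out] := eqVneq (s + psub r s) r; first by rewrite !creation_comp_add prodX_linr.
by rewrite !creation_comp_out // scaler0 addr0.
Qed.

Lemma creation_comp_seq s (eta : X s) xi r : uniq r ->
  \sum_(q <- r) sqnorm (creation_comp eta (fval xi) q) <= (hnorm eta * fnorm xi) ^+ 2.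
Proof.
move=> ur; pose r' := [seq q <- r | s + psub q s == q].
have -> : \sum_(q <- r) sqnorm (creation_comp eta (fval xi) q) =
    \sum_(q <- r') sqnorm (creation_comp eta (fval xi) q).
  rewrite big_filter [RHS]big_mkcond; apply: eq_bigr => q _.
  by case: ifPn => // out; rewrite creation_comp_out ?sqnorm0.
apply: (@le_trans _ _ (\sum_(q <- r') sqnorm eta * sqnorm (fval xi (psub q s)))).
  rewrite !big_filter; apply: ler_sum => q /eqP e.
  have : sqnorm (creation_comp eta (fval xi) (s + psub q s)) <=
      sqnorm eta * sqnorm (fval xi (psub q s)) by rewrite creation_comp_add sqnorm_prodX.
  by rewrite e.
rewrite -mulr_sumr exprMn hnorm_sq ler_wpM2l ?sqnorm_ge0 //.
rewrite -(big_map (psub^~ s) xpredT (fun t => sqnorm (fval xi t))).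
apply: seq_le_fnorm; rewrite map_inj_in_uniq ?filter_uniq // => p q.
rewrite !mem_filter => /andP[/eqP ep _] /andP[/eqP eq _] e.
by rewrite -ep -eq; congr (s + _); exact: e.
Qed.

Definition creation s (eta : X s) xi : fock X := Fock (square_summable_seq (creation_comp_seq eta xi)).

Lemma fnorm_creation s (eta : X s) xi : fnorm (creation eta xi) <= hnorm eta * fnorm xi.
Proof.
apply: fnorm_le => [|r]; first by rewrite mulr_ge0 ?hnorm_ge0 ?fnorm_ge0.
exact: creation_comp_seq.
Qed.

Lemma bounded_creation s (eta : X s) : bounded_operator (creation eta).
Proof.
split; last by exists (hnorm eta); exact: fnorm_creation.
by move=> a x y; apply: fock_eq => r /=; apply: creation_comp_lin.
Qed.

Lemma creation_incl s t (eta : X s) (a : X t) : creation eta (incl a) = incl (prodX eta a).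
Proof.
apply: fock_eq => r; rewrite -[LHS]/(creation_comp eta (fval (incl a)) r).
have [<-|out] := eqVneq (s + psub r s) r; last first.
  rewrite creation_comp_out // fval_incl0 //; apply: contra_neq out => <-.
  by rewrite psubK.
rewrite creation_comp_add; move: (psub r s) => t'.
have [<-|tt] := eqVneq t t'; first by rewrite !fval_incl.
rewrite !fval_incl0 ?prodX0r //.
by apply: contra_neq tt => e; rewrite -(psubK s t) e psubK.
Qed.

Lemma creation_operators_creation s (eta : X s) : creation_operators X (creation eta).
Proof. by split; [exact: bounded_creation|exists s, eta => t xi; apply: creation_incl]. Qed.

End Creation.

(** * Words in the generators *)

Section CreationAlgebra.
Variables (R : realType) (X : subproduct_system R).

Lemma creation_prodX s t (a : X s) (b : X t) : creation (prodX a b) = creation a \o creation b.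
Proof.
apply: bounded_operator_ext; first exact: bounded_creation.
  by apply: bounded_operator_comp; exact: bounded_creation.
by move=> r c /=; rewrite !creation_incl incl_prodXA.
Qed.

Lemma creation_vac : creation (vac X) = id.
Proof.
apply: bounded_operator_ext; [exact: bounded_creation|exact: bounded_operator_id|].
by move=> r c /=; rewrite creation_incl incl_vac_prodX.
Qed.

Lemma creation_lin s a (x y : X s) : creation (a *: x + y) = a *: creation x + creation y.
Proof.
apply: bounded_operator_ext; first exact: bounded_creation.
  by apply: bounded_operator_lin; exact: bounded_creation.
move=> r c; rewrite -[RHS]/(a *: creation x (incl c) + creation y (incl c)) !creation_incl.
by rewrite prodX_linl incl_lin.
Qed.

Lemma creation0 s : creation (0 : X s) = 0.
Proof.
have := creation_lin (-1) (0 : X s) 0; rewrite scaler0 addr0 scaleN1r => {1}->.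
by rewrite addNr.
Qed.

Lemma creationZ s a (x : X s) : creation (a *: x) = a *: creation x.
Proof. by have := creation_lin a x 0; rewrite creation0 !addr0. Qed.

Lemma creation_sum s (I : Type) (r : seq I) (f : I -> X s) :
  creation (\sum_(i <- r) f i) = \sum_(i <- r) creation (f i).
Proof.
elim/big_rec2: _ => [|i x y _ <-]; first exact: creation0.
by have := creation_lin 1 (f i) y; rewrite !scale1r.
Qed.

Lemma creation_operatorsE T : creation_operators X T -> exists s (eta : X s), T = creation eta.
Proof.
case=> bT [s [eta h]]; exists s, eta; apply: bounded_operator_ext => //.
  exact: bounded_creation.
by move=> t a; rewrite h creation_incl.
Qed.

Lemma tensor_creation s (eta : X s) : tensor_algebra X (creation eta).
Proof. by move=> A [_]; apply; apply: creation_operators_creation. Qed.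

Lemma tensor_id : tensor_algebra X id.
Proof. by rewrite -creation_vac; apply: tensor_creation. Qed.

End CreationAlgebra.

Section Words.
Variables (R : realType) (X : subproduct_system R) (B : frame X).
Local Notation m := (dimE B).
Local Notation n := (dimF B).
Local Notation e := (tnth (basisE B)).
Local Notation f := (tnth (basisF B)).

Local Notation wE := (@wordE R X B _).
Local Notation wF := (@wordF R X B _).

(** A type with one element as index set, since the words of length zero are
    indexed by the functions from an empty type. *)
Lemma vac_parseval (I : finType) : #|I| = 1%N -> parseval (fun _ : I => vac X).
Proof.
move=> I1 x.
transitivity (hdot (X 0) x (vac X) *: vac X); last by rewrite sumr_const I1.
have : x \in <[vac X]>%VS.
  suff -> : (<[vac X]> = fullv)%VS by rewrite memvf.
  apply/eqP; rewrite eqEdim subvf dim_fiber0 dim_vline.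
  have -> // : vac X != 0.
  apply/eqP => v0; have := vac_unit X; rewrite v0 hdot0l => /eqP.
  by rewrite eq_sym oner_eq0.
by case/vlineP => k ->; rewrite hdotZl vac_unit mulr1.
Qed.

Lemma prodX_parseval s t (I J : finType) (v : I -> X s) (w : J -> X t) :
  parseval v -> parseval w -> parseval (fun p : I * J => prodX (v p.1) (w p.2)).
Proof.
move=> pv pw.
exact (coisometry_parseval (Umap_coisometry X s t) (tens_parseval (T := ftens X s t) pv pw)).
Qed.

Lemma parseval_reindex (H : hilbert R) (I J : finType) (h : I -> J) (v : J -> H) :
  bijective h -> parseval v -> parseval (v \o h).
Proof.
move=> bh pv x; rewrite {1}(pv x); exact: (reindex h (onW_bij _ bh)).
Qed.

Definition split_word (I : finType) i (s : {ffun 'I_i.+1 -> I}) : I * {ffun 'I_i -> I} :=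
  (s ord0, [ffun k => s (lift ord0 k)]).

Lemma split_word_bij (I : finType) i : bijective (@split_word I i).
Proof.
pose g (p : I * {ffun 'I_i -> I}) : {ffun 'I_i.+1 -> I} :=
  [ffun k => if unlift ord0 k is Some k' then p.2 k' else p.1].
exists g => [s|[a s]].
  apply/ffunP => k; rewrite ffunE; case: unliftP => [k' ->|->] //=.
  by rewrite ffunE.
congr (_, _); first by rewrite ffunE unlift_none.
by apply/ffunP => k; rewrite !ffunE liftK.
Qed.

Lemma wordE_parseval i : parseval (fun s : {ffun 'I_i -> 'I_m} => wE s).
Proof.
elim: i => [|i IH]; first by apply: vac_parseval; rewrite card_ffun !card_ord.
have p := parseval_reindex (@split_word_bij 'I_m i)
  (prodX_parseval (onb_parseval (basisE_onb B)) IH).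
have E (s : {ffun 'I_i.+1 -> 'I_m}) : @wordE R X B i.+1 s =
    prodX (e (split_word s).1) (wE (split_word s).2).
  have -> : ((split_word s).2 : 'I_i -> _) = s \o lift ord0; last by [].
  by apply/funext => k; rewrite ffunE.
by move=> x; rewrite {1}(p x); apply: eq_bigr => s _; rewrite E.
Qed.

Lemma wordF_parseval i : parseval (fun s : {ffun 'I_i -> 'I_n} => wF s).
Proof.
elim: i => [|i IH]; first by apply: vac_parseval; rewrite card_ffun !card_ord.
have p := parseval_reindex (@split_word_bij 'I_n i)
  (prodX_parseval (onb_parseval (basisF_onb B)) IH).
have E (s : {ffun 'I_i.+1 -> 'I_n}) : @wordF R X B i.+1 s =
    prodX (f (split_word s).1) (wF (split_word s).2).
  have -> : ((split_word s).2 : 'I_i -> _) = s \o lift ord0; last by [].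
  by apply/funext => k; rewrite ffunE.
by move=> x; rewrite {1}(p x); apply: eq_bigr => s _; rewrite E.
Qed.

(** [(i, j)] in the unreduced form in which products of words live: [i + 0] is
    not convertible to [i], and this form avoids transports. *)
Definition bideg (i j : nat) : nat * nat := (i, 0%N) + (0%N, j).

Definition word_coords i j (eta : X (bideg i j)) : coords B i j :=
  fun s t => hdot _ eta (prodX (wE s) (wF t)).

Lemma Mmap_word_coords i j (eta : X (bideg i j)) : Mmap (word_coords eta) = eta.
Proof.
rewrite [RHS](prodX_parseval (@wordE_parseval i) (@wordF_parseval j)).
by rewrite /Mmap pair_bigA.
Qed.

Lemma bidegE i j : bideg i j = (i, j).
Proof. by rewrite /bideg; congr pair; exact: addn0. Qed.

Lemma fiber_ind (P : forall s, X s -> Prop) :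
  (forall i j (eta : X (bideg i j)), P _ eta) -> forall s eta, P s eta.
Proof. by move=> h [i j]; rewrite -bidegE; apply: h. Qed.

(** Coordinates in the frame of words reduce completeness to that of the complex
    numbers. *)
Lemma fiber_banach s : banach setT (@hnorm R (X s)).
Proof.
case: s => i j; rewrite -bidegE.
exact: parseval_banach (prodX_parseval (@wordE_parseval i) (@wordF_parseval j)).
Qed.

Lemma tensor_banach : banach (tensor_algebra X) (@opnorm R X).
Proof.
apply: closed_subalgebra_banach (closed_subalgebra_tensor X).
by apply: fock_banach => s; exact: fiber_banach.
Qed.

(** Every creation operator is a linear combination of products of those of the
    basis vectors, because the words span. *)
Lemma tensor_algebra_ind (A : set (fock X -> fock X)) :
  closed_subalgebra A -> A id -> (forall i, A (creation (e i))) -> (forall j, A (creation (f j))) ->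
  tensor_algebra X `<=` A.
Proof.
move=> clA A1 AE AF T; apply; split=> //; have [_ A0 Alin AM _] := clA.
have Asum (I : Type) (r : seq I) (g : I -> fock X -> fock X) :
    (forall i, A (g i)) -> A (\sum_(i <- r) g i).
  move=> h; apply: big_ind => // S S' hS hS'.
  by rewrite -[S]scale1r; apply: Alin.
have AZ a S : A S -> A (a *: S) by move=> h; rewrite -[a *: S]addr0; apply: Alin.
have AwE i (s : 'I_i -> 'I_m) : A (creation (wE s)).
  elim: i s => [|i IH] s; first by rewrite [wE s]/(vac X) creation_vac.
  have -> : creation (wE s) = creation (e (s ord0)) \o creation (wE (s \o lift ord0)).
    exact (@creation_prodX R X (1%N, 0%N) (i, 0%N) _ _).
  exact: AM.
have AwF i (s : 'I_i -> 'I_n) : A (creation (wF s)).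
  elim: i s => [|i IH] s; first by rewrite [wF s]/(vac X) creation_vac.
  have -> : creation (wF s) = creation (f (s ord0)) \o creation (wF (s \o lift ord0)).
    exact (@creation_prodX R X (0%N, 1%N) (0%N, i) _ _).
  exact: AM.
move=> S /creation_operatorsE[s [eta ->]].
move: s eta; apply: fiber_ind => i j eta.
rewrite -(Mmap_word_coords eta) /Mmap creation_sum; apply: (Asum) => s.
rewrite creation_sum; apply: (Asum) => t; rewrite creationZ; apply: AZ.
by rewrite creation_prodX; apply: AM.
Qed.

End Words.

(** * Homomorphisms to truncated polynomials kill the ideal *)

Local Notation "p \mPo lq" := (@mpoly.comp_mpoly _ _ _ lq p) (at level 50).

Section Ideal.
Variables (R : realType) (X : subproduct_system R) (B : frame X).
Local Notation m := (dimE B).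
Local Notation n := (dimF B).
Local Notation e := (tnth (basisE B)).
Local Notation f := (tnth (basisF B)).
Local Notation wE := (@wordE R X B _).
Local Notation wF := (@wordF R X B _).
Local Notation P := (mpoly.mpoly (m + n) R[i]).

(** The swap unitary intertwines the two multiplication maps, and [swap_coef]
    is its matrix in the orthonormal products of basis vectors. *)
Lemma prodX_swap i j :
  prodX (f j) (e i) = \sum_k \sum_l swap_coef k l i j *: prodX (e k) (f l)
  :> X (1%N, 1%N).
Proof.
have pT := tens_parseval (T := ftens X (1%N, 0%N) (0%N, 1%N))
  (onb_parseval (basisE_onb B)) (onb_parseval (basisF_onb B)).
rewrite /prodX -(swapP B) (pT (swap B _)) linear_sum pair_bigA /=.
by apply: eq_bigr => p _; rewrite linearZ.
Qed.

Definition gen_image (N : nat) (rho : (fock X -> fock X) -> mpoly.mpoly N R[i]) :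
    (m + n).-tuple (mpoly.mpoly N R[i]) :=
  [tuple match fintype.split i with inl k => rho (creation (e k)) | inr l => rho (creation (f l)) end | i < m + n].

Section Kill.
Variables (k N : nat) (rho : (fock X -> fock X) -> mpoly.mpoly N R[i]).
Hypothesis rho_lin : forall (a : R[i]) S T, tensor_algebra X S -> tensor_algebra X T ->
  rho (a *: S + T) = a *: rho S + rho T.
Hypothesis rho_mul : forall S T, tensor_algebra X S -> tensor_algebra X T ->
  cong k (rho (S \o T)) (rho S * rho T).
Hypothesis rho_id : cong k (rho id) 1.

Let b := gen_image rho.

Lemma zvar_image i : (zvar i : P) \mPo b = rho (creation (e i)).
Proof.
rewrite mpoly.comp_mpolyXU -tnth_nth tnth_mktuple.
by rewrite (unsplitK (inl i : 'I_m + 'I_n)).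
Qed.

Lemma wvar_image j : (wvar j : P) \mPo b = rho (creation (f j)).
Proof.
rewrite mpoly.comp_mpolyXU -tnth_nth tnth_mktuple.
by rewrite (unsplitK (inr j : 'I_m + 'I_n)).
Qed.

Let mulL s t (x : X s) (y : X t) :
  cong k (rho (creation (prodX x y))) (rho (creation x) * rho (creation y)).
Proof. by rewrite creation_prodX; apply: rho_mul; apply: tensor_creation. Qed.

Let rho0 : rho 0 = 0.
Proof.
have t0 : tensor_algebra X 0 by have [] := closed_subalgebra_tensor X.
by have := rho_lin (-1) t0 t0; rewrite !scaleN1r !addNr.
Qed.

Let linL s (I : finType) (a : I -> R[i]) (x : I -> X s) :
  rho (creation (\sum_i a i *: x i)) = \sum_i a i *: rho (creation (x i)).
Proof.
elim: (index_enum I) => [|i r IH].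
  by rewrite !big_nil -rho0; have := @creation_sum _ X s I [::] (fun=> 0); rewrite !big_nil => ->.
by rewrite !big_cons creation_lin rho_lin ?IH //; apply: tensor_creation.
Qed.

Lemma wordE_image i (s : 'I_i -> 'I_m) :
  cong k (rho (creation (wE s))) ((\prod_l zvar (s l) : P) \mPo b).
Proof.
elim: i s => [|i IH] s.
  by rewrite big_ord0 mpoly.comp_mpoly1 [wE s]/(vac X) creation_vac.
rewrite big_ord_recl rmorphM /= zvar_image.
apply: (@cong_trans _ _ _ _ (rho (creation (e (s ord0))) * rho (creation (wE (s \o lift ord0))))).
  exact (@mulL (1%N, 0%N) (i, 0%N) _ _).
by apply: congM; [exact: cong_refl|apply: IH].
Qed.

Lemma wordF_image i (s : 'I_i -> 'I_n) :
  cong k (rho (creation (wF s))) ((\prod_l wvar (s l) : P) \mPo b).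
Proof.
elim: i s => [|i IH] s.
  by rewrite big_ord0 mpoly.comp_mpoly1 [wF s]/(vac X) creation_vac.
rewrite big_ord_recl rmorphM /= wvar_image.
apply: (@cong_trans _ _ _ _ (rho (creation (f (s ord0))) * rho (creation (wF (s \o lift ord0))))).
  exact (@mulL (0%N, 1%N) (0%N, i) _ _).
by apply: congM; [exact: cong_refl|apply: IH].
Qed.

(** Both kinds of generators of the ideal express equalities between products in
    [X], which [eta |-> rho (creation eta)] respects modulo degree [k]. *)
Lemma idealJ_image g : @idealJ R X B g -> vanish k (g \mPo b).
Proof.
move=> Jg; apply: (Jg [set p | vanish k (p \mPo b)]); split; first split.
- rewrite /mkset mpoly.comp_mpoly0; exact: vanish0.
- move=> p q hp hq; rewrite /mkset mpoly.comp_mpolyD; exact: vanishD hp hq.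
- move=> p q hq; rewrite /mkset rmorphM; exact: vanishM hq.
move=> p [[i [j ->]]|[i [j [a [Ma0 ->]]]]].
  rewrite /mkset; apply/cong0; rewrite /ppoly linearB rmorphM /= wvar_image zvar_image -(subrr (rho (creation (prodX (f j) (e i) : X (1%N, 1%N))))).
  apply: congD; first by apply: cong_sym; exact (@mulL (0%N, 1%N) (1%N, 0%N) _ _).
  apply: congN; rewrite prodX_swap !pair_bigA linL linear_sum /=.
  apply: cong_sum => -[u v] _ /=; rewrite linearZ rmorphM /= zvar_image wvar_image.
  by apply/congZ/cong_sym; exact (@mulL (1%N, 0%N) (0%N, 1%N) _ _).
have e0 : rho (creation (Mmap a)) = 0.
  rewrite Ma0 -rho0; have := @creation_sum _ X (bideg i j) nat [::] (fun=> 0).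
  by rewrite !big_nil => ->.
rewrite /mkset; apply/cong0; rewrite -e0 /Mmap /qpoly !pair_bigA linL linear_sum /=.
apply: cong_sum => -[s t] _ /=; rewrite linearZ rmorphM /=; apply: congZ.
apply: cong_sym; apply: cong_trans (mulL _ _) _.
by apply: congM; [apply: wordE_image|apply: wordF_image].
Qed.

End Kill.
End Ideal.

(** * The symbol of a vector *)

Section Symbol.
Variables (R : realType) (X : subproduct_system R) (B : frame X).
Local Notation m := (dimE B).
Local Notation n := (dimF B).
Local Notation e := (tnth (basisE B)).
Local Notation f := (tnth (basisF B)).
Local Notation wE := (@wordE R X B _).
Local Notation wF := (@wordF R X B _).
Local Notation P := (mpoly.mpoly (m + n) R[i]).
Implicit Types (xi zeta : fock X).

(** This says that [k] is at most [kinv B] (see [kinv_spec]). In this form the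
    bound passes from one system to another. *)
Definition no_small_relation k := forall g, @idealJ R X B g ->
  (mpoly.mmeasure (@mpoly.mdeg (m + n)) g <= k)%N -> g = 0.

Lemma qpoly_lin i j (a : R[i]) (c c1 c2 : coords B i j) :
  (forall s t, c s t = a * c1 s t + c2 s t) -> qpoly c = a *: qpoly c1 + qpoly c2.
Proof.
move=> h; rewrite /qpoly scaler_sumr -big_split; apply: eq_bigr => s _ /=.
rewrite scaler_sumr -big_split; apply: eq_bigr => t _ /=.
by rewrite h scalerDl scalerA.
Qed.

Lemma Mmap_lin i j (a : R[i]) (c c1 c2 : coords B i j) :
  (forall s t, c s t = a * c1 s t + c2 s t) -> Mmap c = a *: Mmap c1 + Mmap c2.
Proof.
move=> h; rewrite /Mmap scaler_sumr -big_split; apply: eq_bigr => s _ /=.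
rewrite scaler_sumr -big_split; apply: eq_bigr => t _ /=.
by rewrite h scalerDl scalerA.
Qed.

Definition monomial i j (s : 'I_i -> 'I_m) (t : 'I_j -> 'I_n) : P :=
  (\prod_k zvar (s k)) * (\prod_l wvar (t l)).

Lemma sum_ones i : (\sum_(k < i) 1 = i)%N.
Proof. by rewrite sum1_card card_ord. Qed.

Lemma vanish_monomial i j (s : 'I_i -> 'I_m) (t : 'I_j -> 'I_n) :
  vanish (i + j) (monomial s t).
Proof.
apply: vanish_mul; rewrite -[X in vanish X _]sum_ones; apply: vanish_prod => k;
  exact: vanishX.
Qed.

Lemma vanish_qpoly i j (a : coords B i j) : vanish (i + j) (qpoly a).
Proof.
apply: vanish_sum => s _; apply: vanish_sum => t _; apply: vanishZ.
exact: vanish_monomial.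
Qed.

Lemma msize_monomial i j (s : 'I_i -> 'I_m) (t : 'I_j -> 'I_n) :
  (mpoly.mmeasure (@mpoly.mdeg (m + n)) (monomial s t) <= (i + j).+1)%N.
Proof.
apply: msizeM_leq; rewrite -[X in (_ <= X.+1)%N]sum_ones; apply: msize_prod_leq => k;
  by rewrite mpoly.msizeX mpoly.mdeg1.
Qed.

Lemma msize_qpoly i j (a : coords B i j) :
  (mpoly.mmeasure (@mpoly.mdeg (m + n)) (qpoly a) <= (i + j).+1)%N.
Proof.
apply: msize_sum_leq => s _; apply: msize_sum_leq => t _.
apply: (leq_trans (mpoly.msizeZ_le _ _)); exact: msize_monomial.
Qed.

Lemma idealJ_qpoly i j (a : coords B i j) : Mmap a = 0 -> @idealJ R X B (qpoly a).
Proof. by move=> Ma A [_]; apply; right; exists i, j, a. Qed.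

Lemma idealJ_ppoly i j : @idealJ R X B (ppoly i j).
Proof. by move=> A [_]; apply; left; exists i, j. Qed.

Definition bounded_functional (phi : fock X -> R[i]) :=
  exists C : R, forall xi, normc (phi xi) <= C * fnorm xi.

Lemma bounded_functional_sum (I : Type) (r : seq I) (Q : pred I) (phi : I -> fock X -> R[i]) :
  (forall i, bounded_functional (phi i)) ->
  bounded_functional (fun xi => \sum_(i <- r | Q i) phi i xi).
Proof.
move=> h; pose C i := projT1 (cid (h i)).
have hC i : forall xi, normc (phi i xi) <= C i * fnorm xi := projT2 (cid (h i)).
exists (\sum_(i <- r | Q i) C i) => xi; rewrite mulr_suml.
by apply: (le_trans (normc_sum _ _ _)); apply: ler_sum.
Qed.

Lemma bounded_functional_dot s (v : X s) (a : R[i]) :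
  bounded_functional (fun xi => hdot (X s) (fval xi s) v * a).
Proof.
exists (hnorm v * normc a) => xi; rewrite normcM mulrAC.
rewrite ler_wpM2r ?normc_ge0 //; apply: (le_trans (Cauchy_Schwarz _ _)).
by rewrite mulrC ler_wpM2l ?hnorm_ge0 ?hnorm_fval.
Qed.

Section SymbolMap.
Variable k : nat.

(** Identifying each word with its monomial maps the Fock space onto the
    quotient of the polynomial ring by [idealJ] and by all degrees at least
    [k]; the coordinates in the frame of words pick a representative,
    continuously. *)
Definition symbol xi : P :=
  \sum_(i < k) \sum_(j < k | (i + j < k)%N) qpoly (@word_coords R X B i j (fval xi (bideg i j))).

Lemma symbol_lin a xi zeta : symbol (a *: xi + zeta) = a *: symbol xi + symbol zeta.
Proof.
rewrite /symbol scaler_sumr -big_split; apply: eq_bigr => i _ /=.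
rewrite scaler_sumr -big_split; apply: eq_bigr => j _ /=.
by apply: qpoly_lin => s t; rewrite /word_coords hdotDl hdotZl.
Qed.

Lemma symbol0 : symbol 0 = 0.
Proof. by have := symbol_lin (-1) 0 0; rewrite !scaleN1r !addNr. Qed.

Lemma symbolD xi zeta : symbol (xi + zeta) = symbol xi + symbol zeta.
Proof. by have := symbol_lin 1 xi zeta; rewrite !scale1r. Qed.

Lemma symbolB xi zeta : symbol (xi - zeta) = symbol xi - symbol zeta.
Proof. by rewrite addrC -scaleN1r symbol_lin scaleN1r addrC. Qed.

Lemma symbolZ a xi : symbol (a *: xi) = a *: symbol xi.
Proof. by have := symbol_lin a xi 0; rewrite symbol0 !addr0. Qed.

Lemma symbol_sum (I : Type) (r : seq I) (x : I -> fock X) :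
  symbol (\sum_(i <- r) x i) = \sum_(i <- r) symbol (x i).
Proof. by elim/big_rec2: _ => [|i u v _ <-]; rewrite ?symbol0 ?symbolD. Qed.

Lemma bounded_symbol (l : {linear P -> R[i]^o}) : bounded_functional (fun xi => l (symbol xi)).
Proof.
have [C hC] : bounded_functional (fun xi => \sum_(i < k) \sum_(j < k | (i + j < k)%N)
  \sum_(s : {ffun 'I_i -> 'I_m}) \sum_(t : {ffun 'I_j -> 'I_n})
  hdot _ (fval xi (bideg i j)) (prodX (wE s) (wF t)) * l (monomial s t)).
  do 4!apply: bounded_functional_sum => ?.
  exact: bounded_functional_dot.
exists C => xi; suff -> : l (symbol xi) = \sum_(i < k) \sum_(j < k | (i + j < k)%N)
  \sum_(s : {ffun 'I_i -> 'I_m}) \sum_(t : {ffun 'I_j -> 'I_n})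
  hdot _ (fval xi (bideg i j)) (prodX (wE s) (wF t)) * l (monomial s t) by [].
rewrite /symbol linear_sum; apply: eq_bigr => i _.
rewrite linear_sum; apply: eq_bigr => j _.
rewrite linear_sum; apply: eq_bigr => s _.
rewrite linear_sum; apply: eq_bigr => t _; rewrite linearZ /monomial.
by [].
Qed.

Hypothesis HJ : no_small_relation k.

(** Here the absence of small relations enters: [a] and the coordinates of
    [Mmap a] differ by an element of the kernel of [Mmap], whose polynomial is
    zero if its degree [i + j] is less than [k]. *)
Lemma symbol_incl i j (a : coords B i j) : cong k (symbol (incl (Mmap a))) (qpoly a).
Proof.
have off i' j' : (i, j) != (i', j') ->
    qpoly (@word_coords R X B i' j' (fval (incl (Mmap a)) (bideg i' j'))) = 0.
  move=> ne; have := @qpoly_lin i' j' (-1) (fun _ _ => 0) (fun _ _ => 0) (fun _ _ => 0).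
  rewrite scaleN1r addNr => q0.
  rewrite fval_incl0; last by apply: contra_neq ne; rewrite -/(bideg i j) !bidegE.
  rewrite -[RHS]q0; last by move=> *; rewrite mulr0 addr0.
  congr qpoly; apply/funext => s; apply/funext => t; exact: hdot0l.
have [ijk|kij] := ltnP (i + j) k; last first.
  have -> : symbol (incl (Mmap a)) = 0.
    rewrite /symbol big1 // => i' _; rewrite big1 // => j' lt; apply: off.
    by apply/eqP => -[e1 e2]; rewrite e1 e2 leqNgt lt in kij.
  by apply: cong_sym; apply/cong0; apply: vanish_leq kij (@vanish_qpoly _ _ a).
have ik : (i < k)%N by apply: leq_ltn_trans ijk; apply: leq_addr.
have jk : (j < k)%N by apply: leq_ltn_trans ijk; apply: leq_addl.
have -> : symbol (incl (Mmap a)) = qpoly (@word_coords R X B i j (Mmap a)).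
  rewrite /symbol (bigD1 (Ordinal ik)) //= (bigD1 (Ordinal jk)) //= big1 ?addr0; last first.
    move=> j' /andP[_ ne]; apply: off; apply: contra_neq ne => -[e1].
    exact: val_inj.
  rewrite big1 ?addr0; last first.
    move=> i' ne; rewrite big1 // => j' _; apply: off; apply: contra_neq ne => -[e1 _].
    exact: val_inj.
  rewrite -[LHS]/(qpoly (@word_coords R X B i j (fval (incl (Mmap a)) (bideg i j)))).
  by rewrite fval_incl.
suff -> : qpoly (word_coords (Mmap a)) = qpoly a by apply: cong_refl.
apply/eqP; rewrite -subr_eq0; apply/eqP.
pose d : coords B i j := fun s t => (-1) * a s t + word_coords (Mmap a) s t.
have <- : qpoly d = qpoly (word_coords (Mmap a)) - qpoly a.
  by rewrite (@qpoly_lin _ _ (-1) _ a (word_coords (Mmap a))) // scaleN1r addrC.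
apply: HJ; last exact: leq_trans (msize_qpoly d) ijk.
apply: idealJ_qpoly; rewrite (@Mmap_lin _ _ (-1) _ a (word_coords (Mmap a))) //.
by rewrite Mmap_word_coords scaleN1r addNr.
Qed.

Lemma symbol_word i j (s : 'I_i -> 'I_m) (t : 'I_j -> 'I_n) :
  cong k (symbol (incl (prodX (wE s) (wF t)))) (monomial s t).
Proof.
pose s0 : {ffun 'I_i -> 'I_m} := [ffun x => s x].
pose t0 : {ffun 'I_j -> 'I_n} := [ffun x => t x].
have es : (s0 : 'I_i -> 'I_m) = s by apply/funext => x; rewrite ffunE.
have et : (t0 : 'I_j -> 'I_n) = t by apply/funext => x; rewrite ffunE.
rewrite -es -et.
(* The coordinates that single out the given word. *)
pose a : coords B i j := fun s t => ((s == s0) && (t == t0))%:R.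
have sum1 (V : lmodType R[i]) (F : {ffun 'I_i -> 'I_m} -> {ffun 'I_j -> 'I_n} -> V) :
    \sum_s \sum_t a s t *: F s t = F s0 t0.
  rewrite (bigD1 s0) //= (bigD1 t0) //= /a !eqxx scale1r.
  rewrite big1 => [|t' /negPf ->]; last by rewrite scale0r.
  rewrite big1 ?addr0 // => s' /negPf ->; rewrite big1 // => t' _.
  by rewrite scale0r.
have := symbol_incl a; rewrite /Mmap /qpoly !sum1; exact.
Qed.

End SymbolMap.
End Symbol.

(** * Multiplicativity of the symbol *)

Section SymbolMul.
Variables (R : realType) (X : subproduct_system R) (B : frame X).
Local Notation m := (dimE B).
Local Notation n := (dimF B).
Local Notation e := (tnth (basisE B)).
Local Notation f := (tnth (basisF B)).
Local Notation wE := (@wordE R X B _).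
Local Notation wF := (@wordF R X B _).
Local Notation P := (mpoly.mpoly (m + n) R[i]).
Local Notation Q := (@symbol R X B).
Implicit Types (xi zeta : fock X).

Lemma bounded_symbol_coef k v (c : P) : exists2 C : R, 0 <= C &
  forall xi, normc (mpoly.mcoeff v (c * Q k xi)) <= C * fnorm xi.
Proof.
have lin : linear (fun p : P => mpoly.mcoeff v (c * p) : R[i]^o).
  by move=> a p q; rewrite mulrDr -scalerAr mpoly.mcoeffD mpoly.mcoeffZ.
pose l : {linear P -> R[i]^o} := HB.pack (fun p : P => mpoly.mcoeff v (c * p) : R[i]^o)
  (GRing.isLinear.Build _ _ _ _ _ lin).
have [C hC] := bounded_symbol k l.
exists `|C| => // xi; apply: (le_trans (hC xi)).
by rewrite ler_wpM2r ?fnorm_ge0 ?ler_norm.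
Qed.

(** Both sides are continuous in [xi], and words span a dense subspace. *)
Lemma symbol_ext k (T : fock X -> fock X) (c : P) : bounded_operator T ->
  (forall i j (s : 'I_i -> 'I_m) (t : 'I_j -> 'I_n),
    let w := incl (prodX (wE s) (wF t)) in cong k (Q k (T w)) (c * Q k w)) ->
  forall xi, cong k (Q k (T xi)) (c * Q k xi).
Proof.
move=> bT h xi v vk.
have [C C0 hC] := bounded_symbol_coef k v 1.
have [D D0 hD] := bounded_symbol_coef k v c.
pose phi xi := mpoly.mcoeff v (Q k (T xi) - c * Q k xi).
have phi_lin a x y : phi (a *: x + y) = a * phi x + phi y.
  rewrite /phi bounded_linP // !symbol_lin mulrDr -scalerAr opprD addrACA -scalerBr.
  by rewrite [LHS]mpoly.mcoeffD mpoly.mcoeffZ.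
apply: (@fock_functional_ext _ _ phi (C * opnorm T + D)) => //.
  move=> x; rewrite /phi mpoly.mcoeffB; apply: (le_trans (le_normcD _ _)).
  rewrite normcN mulrDl; apply: lerD (hD x).
  rewrite -[Q k _]mul1r; apply: (le_trans (hC _)).
  by rewrite -mulrA ler_wpM2l ?opnorm_bound.
have phi_sum (I : finType) (a : I -> R[i]) (x : I -> fock X) :
    (forall i, phi (x i) = 0) -> phi (\sum_i a i *: x i) = 0.
  move=> hx; have phi0 : phi 0 = 0.
    by have := phi_lin (-1) 0 0; rewrite scaleN1r addNr mulN1r addNr.
  elim: (index_enum I) => [|i r IH]; first by rewrite big_nil.
  by rewrite big_cons phi_lin hx IH mulr0 addr0.
move=> s a; move: s a; apply: fiber_ind => i j eta.
rewrite -(Mmap_word_coords B eta) /Mmap pair_bigA incl_sum /=.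
under eq_bigr do rewrite inclZ.
apply: phi_sum => -[s t] /=; exact: (h _ _ s t v vk).
Qed.

Definition cons_word (I : Type) i (a : I) (s : 'I_i -> I) : 'I_i.+1 -> I :=
  fun l => if unlift ord0 l is Some l' then s l' else a.

Lemma cons_word0 (I : Type) i (a : I) (s : 'I_i -> I) : cons_word a s ord0 = a.
Proof. by rewrite /cons_word unlift_none. Qed.

Lemma cons_word_lift (I : Type) i (a : I) (s : 'I_i -> I) : cons_word a s \o lift ord0 = s.
Proof. by apply/funext => l; rewrite /= /cons_word liftK. Qed.

Lemma wordE_cons i a (s : 'I_i -> 'I_m) :
  @wordE R X B i.+1 (cons_word a s) = @prodX R X (1%N, 0%N) (i, 0%N) (e a) (wE s).
Proof. by rewrite [LHS]/= cons_word0 cons_word_lift. Qed.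

Lemma wordF_cons i a (s : 'I_i -> 'I_n) :
  @wordF R X B i.+1 (cons_word a s) = @prodX R X (0%N, 1%N) (0%N, i) (f a) (wF s).
Proof. by rewrite [LHS]/= cons_word0 cons_word_lift. Qed.

Lemma prod_cons (I : Type) i (a : I) (s : 'I_i -> I) (g : I -> P) :
  \prod_l g (cons_word a s l) = g a * \prod_l g (s l).
Proof.
rewrite big_ord_recl cons_word0; congr (_ * _); apply: eq_bigr => l _.
by rewrite -[in RHS](cons_word_lift a s).
Qed.

Lemma vanish2_ppoly i j : vanish 2 (ppoly i j : P).
Proof.
apply: vanishB; first by apply: (@vanish_mul _ _ 1 1); exact: vanishX.
apply: vanish_sum => u _; apply: vanish_sum => v _; apply: vanishZ.
by apply: (@vanish_mul _ _ 1 1); exact: vanishX.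
Qed.

Section Mul.
Variable k : nat.
Hypothesis HJ : no_small_relation B k.

Lemma symbol_E i xi : cong k (Q k (creation (e i) xi)) (zvar i * Q k xi).
Proof.
apply: symbol_ext; first exact: bounded_creation.
move=> a b s t w; rewrite /w creation_incl incl_prodXA.
have := symbol_word HJ (cons_word i s) t; rewrite wordE_cons => h.
apply: (cong_trans h); rewrite /monomial prod_cons -mulrA.
by apply: congM; [exact: cong_refl|apply/cong_sym/symbol_word].
Qed.

(** The commutation relations are quadratic: either [k <= 2], or they are small
    relations and therefore zero. *)
Lemma vanish_ppoly i j : vanish k (ppoly i j : P).
Proof.
have [k2|k3] := leqP k 2; first exact: vanish_leq k2 (vanish2_ppoly i j).
have sX (x y : 'I_(m + n)) : (mpoly.mmeasure (@mpoly.mdeg (m + n))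
    (mpoly.mpolyX R[i] (mpoly.mnm1 x) * mpoly.mpolyX R[i] (mpoly.mnm1 y)) <= 3)%N.
  by apply: (@msizeM_leq _ _ 1 1); rewrite mpoly.msizeX mpoly.mdeg1.
suff -> : ppoly i j = 0 :> P by apply: vanish0.
apply: (HJ (@idealJ_ppoly _ _ B i j)); apply: leq_trans k3.
apply: (leq_trans (mpoly.msizeD_le _ _)); rewrite geq_max mpoly.msizeN sX /=.
apply: msize_sum_leq => u _; apply: msize_sum_leq => v _.
by apply: (leq_trans (mpoly.msizeZ_le _ _)); exact: sX.
Qed.

(** A generator [f j] moves to the right through the letters of the first kind;
    each exchange costs a commutation relation, which [vanish_ppoly] makes
    negligible. *)
Lemma symbol_F_word j i (s : 'I_i -> 'I_m) i' (t : 'I_i' -> 'I_n) :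
  cong k (Q k (creation (f j) (incl (prodX (wE s) (wF t))))) (wvar j * monomial s t).
Proof.
elim: i j s => [|i IH] j s.
  rewrite [wE s]/(vac X) incl_vac_prodX creation_incl -(incl_vac_prodX (prodX (f j) (wF t))).
  have := symbol_word HJ s (cons_word j t); rewrite wordF_cons /monomial prod_cons.
  by rewrite mulrCA; exact.
have -> : s = cons_word (s ord0) (s \o lift ord0).
  apply/funext => l; rewrite /cons_word; case: unliftP => [l' ->|->] //.
move: (s ord0) (s \o lift ord0) => a s' {s}.
pose zeta := incl (prodX (wE s') (wF t)).
have -> : incl (prodX (@wordE R X B i.+1 (cons_word a s')) (wF t)) = creation (e a) zeta.
  by rewrite creation_incl incl_prodXA -wordE_cons.
have -> : creation (f j) (creation (e a) zeta) =
    \sum_p swap_coef p.1 p.2 a j *: creation (e p.1) (creation (f p.2) zeta).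
  have -> : creation (f j) (creation (e a) zeta) = creation (prodX (f j) (e a) : X (1%N, 1%N)) zeta.
    by rewrite -[LHS]/((creation (f j) \o creation (e a)) zeta) -creation_prodX.
  rewrite prodX_swap pair_bigA creation_sum /=.
  have -> (I : finType) (g : I -> fock X -> fock X) : (\sum_i g i) zeta = \sum_i g i zeta.
    by elim/big_rec2: _ => // q u v _ <-.
  apply: eq_bigr => p _; rewrite creationZ; congr (_ *: _).
  exact (congr1 (fun T => T zeta) (@creation_prodX R X (1%N, 0%N) (0%N, 1%N) (e p.1) (f p.2))).
rewrite symbol_sum /=.
have hp p : cong k (Q k (creation (e p.1) (creation (f p.2) zeta)))
    (zvar p.1 * (wvar p.2 * monomial s' t)).
  by apply: (cong_trans (symbol_E _ _)); apply: congM; [exact: cong_refl|exact: IH].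
apply: (@cong_trans _ _ _ _ ((wvar j * zvar a - ppoly a j) * monomial s' t)).
  have -> : wvar j * zvar a - ppoly a j =
      \sum_p swap_coef p.1 p.2 a j *: (zvar p.1 * wvar p.2) :> P.
    by rewrite /ppoly opprB addrC subrK pair_bigA.
  rewrite mulr_suml; apply: cong_sum => p _; rewrite symbolZ -scalerAl -mulrA; apply: congZ; exact: hp.
have -> : monomial (cons_word a s') t = zvar a * monomial s' t :> P.
  by rewrite /monomial prod_cons mulrA.
have := vanishN (vanishM (monomial s' t) (vanish_ppoly a j)).
by rewrite /cong mulrBl [wvar j * (zvar a * _)]mulrA addrAC subrr add0r mulrC.
Qed.

Lemma symbol_F j xi : cong k (Q k (creation (f j) xi)) (wvar j * Q k xi).
Proof.
apply: symbol_ext; first exact: bounded_creation.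
move=> a b s t w; apply: (cong_trans (symbol_F_word j s t)).
by apply: congM; [exact: cong_refl|apply/cong_sym/symbol_word].
Qed.

Lemma symbol_vac : cong k (Q k (incl (vac X))) 1.
Proof.
have := @symbol_word _ _ _ _ HJ 0 0 (fun i => match notF (ltn_ord i) with end) (fun i => match notF (ltn_ord i) with end).
by rewrite /monomial !big_ord0 mulr1 incl_vac_prodX.
Qed.

(** Hence [T |-> symbol (T vac)] is multiplicative modulo degree [k]. The
    property for all vectors [xi], rather than for those of the form [S vac], is
    the one that visibly survives products; it survives limits because the
    coefficients of the symbol are bounded functionals. *)
Theorem symbol_mul T : tensor_algebra X T ->
  forall xi, cong k (Q k (T xi)) (Q k (T (incl (vac X))) * Q k xi).
Proof.
have clX := closed_subalgebra_tensor X.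
have [Xb X0 Xlin XM Xcl] := clX.
move=> XT; suff [] : (tensor_algebra X `&` [set T | forall xi,
   cong k (Q k (T xi)) (Q k (T (incl (vac X))) * Q k xi)]) T by [].
have creationP s (g : X s) c : (forall xi, cong k (Q k (creation g xi)) (c * Q k xi)) ->
    forall xi, cong k (Q k (creation g xi)) (Q k (creation g (incl (vac X))) * Q k xi).
  move=> h xi; apply: (cong_trans (h xi)); apply: congM; last exact: cong_refl.
  apply: cong_sym; apply: (cong_trans (h _)).
  by rewrite -[X in cong _ _ X]mulr1; apply: congM; [exact: cong_refl|exact: symbol_vac].
move: T XT; apply: tensor_algebra_ind.
- split.
  + by move=> S [/Xb].
  + by split=> // xi; rewrite symbol0 mul0r; apply: cong_refl.
  + move=> a S S' [XS hS] [XS' hS']; split=> [|xi]; first exact: Xlin.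
    rewrite !symbol_lin mulrDl -scalerAl.
    by apply: congD; [apply: congZ; exact: hS|exact: hS'].
  + move=> S S' [XS hS] [XS' hS']; split=> [|xi]; first exact: XM.
    apply: (cong_trans (hS _)); apply: (@cong_trans _ _ _ _
      (Q k (S (incl (vac X))) * (Q k (S' (incl (vac X))) * Q k xi))).
      by apply: congM; [exact: cong_refl|exact: hS'].
    rewrite mulrA; apply: congM; last exact: cong_refl.
    by apply: cong_sym; exact: hS.
  move=> S bS h; have XS : tensor_algebra X S.
    by apply: Xcl => // eps e0; have [S' [XS' _] lt] := h eps e0; exists S'.
  split=> // xi v vk.
  have [C C0 hC] := bounded_symbol_coef k v 1.
  have [D D0 hD] := bounded_symbol_coef k v (Q k xi).
  pose K := C * fnorm xi + D * fnorm (incl (vac X)).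
  have K0 : 0 <= K by rewrite addr_ge0 ?mulr_ge0 ?fnorm_ge0.
  apply: eq0_normc; apply/eqP; rewrite eq_le normc_ge0 andbT.
  apply/ler_addgt0Pl => eps e0; rewrite addr0.
  have K1 : 0 < K + 1 by rewrite ltr_wpDl.
  have [S' [XS' hS'] lt] := h _ (divr_gt0 e0 K1).
  have bD := bounded_operatorB bS (Xb _ XS').
  have -> : mpoly.mcoeff v (Q k (S xi) - Q k (S (incl (vac X))) * Q k xi) =
    mpoly.mcoeff v (1 * Q k ((S - S') xi)) -
    mpoly.mcoeff v (Q k xi * Q k ((S - S') (incl (vac X)))).
    have := hS' xi v vk; rewrite !symbolB mul1r !mulrBr !mpoly.mcoeffB ![_ * Q k xi]mulrC => /eqP.
    by rewrite subr_eq0 => /eqP ->; rewrite opprB addrA subrK.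
  apply: (le_trans (le_normcD _ _)); rewrite normcN.
  apply: (@le_trans _ _ (K * opnorm (S - S'))).
    rewrite mulrDl; apply: lerD.
      apply: (le_trans (hC _)); rewrite -mulrA ler_wpM2l // mulrC; exact: opnorm_bound.
    apply: (le_trans (hD _)); rewrite -mulrA ler_wpM2l // mulrC; exact: opnorm_bound.
  apply: (@le_trans _ _ ((K + 1) * (eps / (K + 1)))); last first.
    by rewrite mulrC mulfVK ?gt_eqF.
  by apply: ler_pM => //; [exact: opnorm_ge0|rewrite lerDl|exact: ltW].
- split=> [|xi]; first exact: tensor_id.
  rewrite -[X in cong _ X _]mul1r; apply: congM; last exact: cong_refl.
  by apply/cong_sym/symbol_vac.
- by move=> i; split; [exact: tensor_creation|exact: creationP (symbol_E i)].
- by move=> j; split; [exact: tensor_creation|exact: creationP (symbol_F j)].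
Qed.

End Mul.
End SymbolMul.

(** * The invariant and its transfer *)

(** [None] is the value of [kinv] when the ideal is zero; it plays the role of
    infinity. *)
Definition leq_option (k : nat) (o : option nat) : bool :=
  if o is Some d then (k <= d)%N else true.

Section Degree2.
Variables (R : realType) (X : subproduct_system R) (B : frame X).
Local Notation m := (dimE B).
Local Notation n := (dimF B).
Local Notation e := (tnth (basisE B)).
Local Notation f := (tnth (basisF B)).
Local Notation wE := (@wordE R X B _).
Local Notation wF := (@wordF R X B _).
Local Notation P := (mpoly.mpoly (m + n) R[i]).
Local Notation msz := (mpoly.mmeasure (@mpoly.mdeg (m + n))).

(** The map [xi |-> \sum_k hdot _ (fval xi s0) (v k) *: p k] takes [Mmap a] to
    [qpoly a] as soon as it takes each word to its monomial. *)
Lemma qpoly_eq0 i j (a : coords B i j) (s0 : nat * nat) (I : finType) (v : I -> X s0) (p : I -> P) :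
  (forall s t, \sum_k hdot _ (fval (incl (prodX (wE s) (wF t))) s0) (v k) *: p k
     = @monomial R X B i j s t) ->
  Mmap a = 0 -> qpoly a = 0.
Proof.
move=> h Ma.
pose psi xi := \sum_k hdot _ (fval xi s0) (v k) *: p k.
have psi_lin c x y : psi (c *: x + y) = c *: psi x + psi y.
  rewrite /psi scaler_sumr -big_split; apply: eq_bigr => k _ /=.
  by rewrite hdotDl hdotZl scalerDl scalerA.
have psi0 : psi 0 = 0 by have := psi_lin (-1) 0 0; rewrite !scaleN1r !addNr.
have psi_sum (J : finType) (c : J -> R[i]) (x : J -> fock X) :
    psi (\sum_i c i *: x i) = \sum_i c i *: psi (x i).
  elim: (index_enum J) => [|q r IH]; first by rewrite !big_nil.
  by rewrite !big_cons psi_lin IH.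
have : psi (incl (Mmap a)) = 0 by rewrite Ma incl0.
rewrite /Mmap pair_bigA incl_sum /=.
under eq_bigr do rewrite inclZ.
rewrite psi_sum => <-; rewrite /qpoly pair_bigA.
by apply: eq_bigr => -[s t] _; rewrite /psi h.
Qed.

Lemma vanish2_qpoly i j (a : coords B i j) : Mmap a = 0 -> vanish 2 (qpoly a).
Proof.
move=> Ma; have [ij2|] := leqP 2 (i + j).
  exact: vanish_leq ij2 (vanish_qpoly a).
have dot_onb (I : finType) (q : I -> P) (d : I -> I -> R[i]) x :
    (forall k, d x k = (x == k)%:R) -> \sum_k d x k *: q k = q x.
  move=> hd; rewrite (bigD1 x) //= hd eqxx scale1r big1 ?addr0 // => k ne.
  by rewrite hd eq_sym (negPf ne) scale0r.
suff : (i + j < 2)%N -> qpoly a = 0 by move=> h /h ->; apply: vanish0.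
case: i j a Ma => [|[|i]] [|[|j]] a Ma //= _.
- apply: (@qpoly_eq0 _ _ _ 0 unit (fun _ => vac X) (fun _ => 1)) => // s t.
  rewrite (bigD1 tt) // big1 => [|[]] //; apply: (etrans (addr0 _)).
  rewrite /monomial !big_ord0 mulr1.
  by rewrite [wE s]/(vac X) [wF t]/(vac X) incl_prodX_vac fval_incl vac_unit scale1r.
- apply: (@qpoly_eq0 _ _ _ (0%N, 1%N) 'I_n f (fun l => wvar l)) => // s t.
  rewrite /monomial big_ord0 mul1r big_ord1 [wE s]/(vac X) incl_vac_prodX.
  have -> : incl (wF t) = incl (f (t ord0)) by rewrite -(incl_prodX_vac (f (t ord0))).
  rewrite fval_incl.
  apply: (dot_onb _ (fun l => wvar l) (fun x k => hdot _ (f x) (f k))) => k.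
  exact: onb_dot (basisF_onb B) _ _.
- apply: (@qpoly_eq0 _ _ _ (1%N, 0%N) 'I_m e (fun l => zvar l)) => // s t.
  rewrite /monomial big_ord0 mulr1 big_ord1 [wF t]/(vac X) incl_prodX_vac.
  have -> : incl (wE s) = incl (e (s ord0)) by rewrite -(incl_prodX_vac (e (s ord0))).
  rewrite fval_incl.
  apply: (dot_onb _ (fun l => zvar l) (fun x k => hdot _ (e x) (e k))) => k.
  exact: onb_dot (basisE_onb B) _ _.
Qed.

(** In bidegrees [(0, 0)], [(1, 0)] and [(0, 1)] the map [Mmap] is injective, the
    words being orthonormal there; all other generators have degree at least
    [2]. *)
Lemma no_small_relation2 : no_small_relation B 2.
Proof.
move=> g Jg; apply: vanish_small; apply: (Jg [set p | vanish 2 p]); split; first split.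
- exact: vanish0.
- by move=> p q; apply: vanishD.
- by move=> p q; apply: vanishM.
move=> p [[i [j ->]]|[i [j [a [Ma ->]]]]]; last exact: vanish2_qpoly.
exact: vanish2_ppoly.
Qed.

Lemma kinv_spec k : no_small_relation B k <-> leq_option k (kinv B).
Proof.
rewrite /kinv /leq_option; case: pselect => [ex|nex].
  case: ex_minnP => d /andP[d0 /asboolP[g Jg gd]] dmin; split=> [h|kd g' Jg' g'k].
    rewrite leqNgt; apply/negP => dk; have g0 : g = 0 by apply: h => //; rewrite gd.
    by move: gd; rewrite g0 mpoly.msize0.
  have [//|g'0] := eqVneq g' 0.
  have : (0 < msz g')%N by rewrite lt0n mpoly.msize_poly_eq0.
  case E : (msz g') => [//|d'] _; exfalso.
  suff : (d <= d')%N by rewrite leqNgt (leq_trans _ kd) // -E.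
  apply: dmin; apply/andP; split; last by apply/asboolP; exists g'.
  rewrite lt0n; apply: contra_neq g'0 => d'0; apply: (no_small_relation2 Jg').
  by rewrite E d'0.
split=> // _ g Jg gk; have [//|g0] := eqVneq g 0.
have : (0 < msz g)%N by rewrite lt0n mpoly.msize_poly_eq0.
case E : (msz g) => [//|d] _; exfalso; apply: nex; exists d; apply/andP; split.
  rewrite lt0n; apply: contra_neq g0 => d0; apply: (no_small_relation2 Jg).
  by rewrite E d0.
by apply/asboolP; exists g.
Qed.
End Degree2.

(** Surjective bounded homomorphisms suffice for the transfer, and both an
    isomorphism and its inverse are of this kind. *)
Definition bounded_epimorphism (R : realType) (X Y : subproduct_system R)
    (Phi : (fock X -> fock X) -> (fock Y -> fock Y)) : Prop :=
  [/\ (forall T, tensor_algebra X T -> tensor_algebra Y (Phi T)),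
      (forall S, tensor_algebra Y S -> exists2 T, tensor_algebra X T & Phi T = S),
      (forall (a : R[i]) S T, tensor_algebra X S -> tensor_algebra X T ->
        Phi (a *: S + T) = a *: Phi S + Phi T),
      (forall S T, tensor_algebra X S -> tensor_algebra X T ->
        Phi (S \o T) = Phi S \o Phi T) &
      (exists M : R, forall T, tensor_algebra X T ->
        opnorm (Phi T) <= M * opnorm T)].

Section Transfer.
Variables (R : realType) (X Y : subproduct_system R) (BX : frame X) (BY : frame Y).
Variable Phi : (fock X -> fock X) -> (fock Y -> fock Y).
Hypothesis epi : bounded_epimorphism Phi.
Variable k : nat.
Hypothesis HJ : no_small_relation BY k.
Local Notation dX := (dimE BX + dimF BX)%N.
Local Notation dY := (dimE BY + dimF BY)%N.
Local Notation Q := (@symbol R Y BY k).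

Let Phi_in := let: And5 h _ _ _ _ := epi in h.
Let Phi_onto := let: And5 _ h _ _ _ := epi in h.
Let Phi_lin := let: And5 _ _ h _ _ := epi in h.
Let Phi_mul := let: And5 _ _ _ h _ := epi in h.
Let Phi_bd := let: And5 _ _ _ _ h := epi in h.

Lemma epimorphism_id : Phi id = id.
Proof.
have [T XT e] := Phi_onto (@tensor_id R Y).
have h : Phi (id \o T) = Phi id \o Phi T by apply: Phi_mul => //; apply: tensor_id.
transitivity (Phi id \o Phi T); first by rewrite e.
by rewrite -h; exact: e.
Qed.

Let rho T := Q (Phi T (incl (vac Y))).
Let b := gen_image BX rho.

Let rho_lin (a : R[i]) S T : tensor_algebra X S -> tensor_algebra X T ->
  rho (a *: S + T) = a *: rho S + rho T.
Proof.
move=> XS XT; rewrite /rho Phi_lin //.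
rewrite -[(a *: Phi S + Phi T) _]/(a *: Phi S (incl (vac Y)) + Phi T (incl (vac Y))).
exact: symbol_lin.
Qed.

Let rho_mul S T : tensor_algebra X S -> tensor_algebra X T ->
  cong k (rho (S \o T)) (rho S * rho T).
Proof.
move=> XS XT; rewrite /rho (Phi_mul XS XT).
exact (symbol_mul HJ (Phi_in XS) (Phi T (incl (vac Y)))).
Qed.

Let rho_id : cong k (rho id) 1.
Proof. by rewrite /rho epimorphism_id; apply: symbol_vac. Qed.

Let rho_onto (p : mpoly.mpoly dY R[i]) : exists2 T, tensor_algebra X T & cong k (rho T) p.
Proof.
have [_ _ Xlin XM _] := closed_subalgebra_tensor X.
elim/comp_mpoly_ind: p => [|a p q [S XS hS] [T XT hT]|p q [S XS hS] [T XT hT]|i].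
- by exists id; [exact: tensor_id|].
- exists (a *: S + T); first exact: Xlin.
  by rewrite (rho_lin a XS XT); exact (congD (congZ a hS) hT).
- exists (S \o T); first exact: XM.
  exact (cong_trans (rho_mul XS XT) (congM hS hT)).
have gen s (g : Y s) c : (forall xi, cong k (Q (creation g xi)) (c * Q xi)) ->
    exists2 T, tensor_algebra X T & cong k (rho T) c.
  move=> h; have [T XT e] := Phi_onto (tensor_creation g); exists T => //.
  rewrite /rho e; apply: (cong_trans (h _)); rewrite -[X in cong _ _ X]mulr1.
  by apply: congM; [exact: cong_refl|exact: symbol_vac].
rewrite -(splitK i); case: (fintype.split i) => j.
  exact: gen (symbol_E HJ j).
exact: gen (symbol_F HJ j).
Qed.

(* This subspace of the target is finite dimensional, hence closed: it is cut
   out by the equations of [comp_mpoly_span_closed], which are bounded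
   functionals of [T]. *)
Let rho_image T : tensor_algebra X T ->
  exists g : mpoly.mpoly dX R[i], vanish k (rho T - (g \mPo b)).
Proof.
have [Xb X0 Xlin XM Xcl] := closed_subalgebra_tensor X.
move=> XT; suff [] : (tensor_algebra X `&` [set T |
  exists g : mpoly.mpoly dX R[i], vanish k (rho T - (g \mPo b))]) T by [].
move: T XT; apply: (tensor_algebra_ind (B := BX)).
- split.
  + by move=> S [/Xb].
  + split=> //; exists 0; rewrite mpoly.comp_mpoly0.
    have := rho_lin (-1) X0 X0; rewrite !scaleN1r !addNr => ->.
    exact: cong_refl.
  + move=> a S T [XS [g hg]] [XT [h hh]]; split; first exact: Xlin.
    exists (a *: g + h).
    rewrite (rho_lin a XS XT) mpoly.comp_mpolyD mpoly.comp_mpolyZ.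
    exact (congD (congZ a hg) hh).
  + move=> S T [XS [g hg]] [XT [h hh]]; split; first exact: XM.
    exists (g * h); rewrite rmorphM.
    exact (cong_trans (rho_mul XS XT) (congM hg hh)).
  move=> T bT h; have XT : tensor_algebra X T.
    by apply: Xcl => // eps e0; have [S [XS _] lt] := h eps e0; exists S.
  split=> //; have [K hK] := comp_mpoly_span_closed k b.
  apply/hK => j.
  have lin : linear (fun p : mpoly.mpoly dY R[i] =>
      \sum_v mpoly.mcoeff (mon v) p * K v j : R[i]^o).
    move=> a p q; rewrite scaler_sumr -big_split; apply: eq_bigr => v _ /=.
    by rewrite mpoly.mcoeffD mpoly.mcoeffZ mulrDl -mulrA.
  pose l : {linear mpoly.mpoly dY R[i] -> R[i]^o} := HB.pack (fun p : mpoly.mpoly dY R[i] =>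
      \sum_v mpoly.mcoeff (mon v) p * K v j : R[i]^o)
    (GRing.isLinear.Build _ _ _ _ _ lin).
  have [C hC] := bounded_symbol k l; have [M hM] := Phi_bd.
  pose D := `|C| * (`|M| * fnorm (incl (vac Y))).
  have D0 : 0 <= D by rewrite !mulr_ge0 ?fnorm_ge0.
  rewrite -[LHS]/(l (rho T)); apply: eq0_normc; apply/eqP.
  rewrite eq_le normc_ge0 andbT; apply/ler_addgt0Pl => eps e0; rewrite addr0.
  have D1 : 0 < D + 1 by rewrite ltr_wpDl.
  have [S [XS /hK /(_ j) hS] lt] := h _ (divr_gt0 e0 D1).
  have XD : tensor_algebra X (T - S).
    have -> : T - S = -1 *: S + T by rewrite scaleN1r addrC.
    exact: Xlin.
  have -> : l (rho T) = l (rho (T - S)).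
    have -> : T - S = -1 *: S + T by rewrite scaleN1r addrC.
    have lS : l (rho S) = 0 by exact: hS.
    rewrite (rho_lin (-1) XS XT); apply: esym; apply: (etrans (linearP l _ _ _)).
    by rewrite lS scaler0 add0r.
  have bD := (Xb _ XD).
  have Yb : bounded_operator (Phi (T - S)).
    have [h' _ _ _ _] := closed_subalgebra_tensor Y.
    exact (h' _ (Phi_in XD)).
  apply: (le_trans (hC _)); apply: (@le_trans _ _ (D * opnorm (T - S))).
    have o0 := opnorm_ge0 bD.
    apply: (@le_trans _ _ (`|C| * fnorm (Phi (T - S) (incl (vac Y))))).
      by rewrite ler_wpM2r ?fnorm_ge0 ?ler_norm.
    rewrite /D -mulrA ler_wpM2l //; apply: (le_trans (opnorm_bound _ Yb)).
    rewrite mulrAC ler_wpM2r ?fnorm_ge0 //; apply: (le_trans (hM _ XD)).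
    by rewrite ler_wpM2r ?ler_norm.
  apply: (@le_trans _ _ ((D + 1) * (eps / (D + 1)))); last first.
    by rewrite mulrC mulfVK ?gt_eqF.
  by apply: ler_pM => //; [exact: opnorm_ge0|rewrite lerDl|exact: ltW].
- split; first exact: tensor_id.
  by exists 1; rewrite mpoly.comp_mpoly1; exact: rho_id.
- move=> i; split; first exact: tensor_creation.
  by exists (zvar i); rewrite zvar_image; exact: cong_refl.
- move=> j; split; first exact: tensor_creation.
  by exists (wvar j); rewrite wvar_image; exact: cong_refl.
Qed.

Let comp_onto (p : mpoly.mpoly dY R[i]) :
  exists g : mpoly.mpoly dX R[i], vanish k (p - (g \mPo b)).
Proof.
have [T XT hT] := rho_onto p; have [g hg] := rho_image XT.
by exists g; apply: cong_trans (cong_sym hT) hg.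
Qed.

Lemma transfer_card :
  (#|{: mpoly.bmultinom dY k}| <= #|{: mpoly.bmultinom dX k}|)%N.
Proof. exact: comp_mpoly_onto_card comp_onto. Qed.

Lemma transfer_no_small_relation : dY = dX -> no_small_relation BX k.
Proof.
move=> d g Jg gk; apply: (comp_mpoly_onto_inj comp_onto d gk).
exact (idealJ_image rho_lin rho_mul rho_id Jg).
Qed.

End Transfer.

Lemma epimorphism_dim (R : realType) (X Y : subproduct_system R) (BX : frame X) (BY : frame Y) Phi :
  @bounded_epimorphism R X Y Phi -> (dimE BY + dimF BY <= dimE BX + dimF BX)%N.
Proof.
move=> epi; have := transfer_card BX epi (@no_small_relation2 R Y BY).
by rewrite !card_bmultinom2.
Qed.

(** The frames provide the completeness of the tensor algebras, which the open
    mapping theorem requires. *)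
Lemma bounded_inverse (R : realType) (X Y : subproduct_system R) (BX : frame X) (BY : frame Y) Phi :
  @bounded_algebra_isomorphism R X Y Phi ->
  bounded_epimorphism Phi /\ exists Psi, @bounded_epimorphism R Y X Psi.
Proof.
case=> -[fun_ inj_ surj_] lin mul [M bd].
have inj S T : tensor_algebra X S -> tensor_algebra X T -> Phi S = Phi T -> S = T.
  by move=> XS XT; apply: inj_; rewrite inE.
have onto S : tensor_algebra Y S -> exists2 T, tensor_algebra X T & Phi T = S.
  by move=> YS; have [T XT e] := surj_ _ YS; exists T.
split; first by split=> //; exists M.
have [K hK] := open_mapping (tensor_banach BX) (tensor_banach BY) fun_ lin onto bd.
have [_ _ Xlin XM _] := closed_subalgebra_tensor X.
have [_ _ Ylin YM _] := closed_subalgebra_tensor Y.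
have pick S : exists T, tensor_algebra Y S ->
    [/\ tensor_algebra X T, Phi T = S & opnorm T <= K * opnorm S].
  have [YS|nYS] := pselect (tensor_algebra Y S); last by exists id.
  by have [T XT [e le]] := hK S YS; exists T.
have [Psi hPsi] := choice pick.
have PsiX S : tensor_algebra Y S -> tensor_algebra X (Psi S) by move=> /hPsi[].
have PhiK S : tensor_algebra Y S -> Phi (Psi S) = S by move=> /hPsi[].
exists Psi; split=> //.
- move=> T XT; exists (Phi T); first exact: fun_.
  exact (inj _ _ (PsiX _ (fun_ T XT)) XT (PhiK _ (fun_ T XT))).
- move=> a S T YS YT; apply: inj; [exact (PsiX _ (Ylin a S T YS YT))|exact (Xlin a _ _ (PsiX _ YS) (PsiX _ YT))|].
  rewrite (PhiK _ (Ylin a S T YS YT)) (lin _ _ _ (PsiX _ YS) (PsiX _ YT)).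
  by rewrite (PhiK _ YS) (PhiK _ YT).
- move=> S T YS YT; apply: inj; [exact (PsiX _ (YM S T YS YT))|exact (XM _ _ (PsiX _ YS) (PsiX _ YT))|].
  rewrite (PhiK _ (YM S T YS YT)) (mul _ _ (PsiX _ YS) (PsiX _ YT)).
  by rewrite (PhiK _ YS) (PhiK _ YT).
by exists K => S /hPsi[].
Qed.

Theorem corollary6p4 (R : realType) (X Y : subproduct_system R)
    (BX : frame X) (BY : frame Y) :
  continuously_isomorphic X Y -> kinv BX = kinv BY.
Proof.
case=> Phi /(bounded_inverse BX BY)[epi [Psi epi']].
have d : (dimE BX + dimF BX = dimE BY + dimF BY)%N.
  by apply/eqP; rewrite eqn_leq (epimorphism_dim BY BX epi') (epimorphism_dim BX BY epi).
have same k : no_small_relation BX k <-> no_small_relation BY k.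
  split=> h; first exact (transfer_no_small_relation epi' h d).
  exact (transfer_no_small_relation epi h (esym d)).
have spec k : leq_option k (kinv BX) = leq_option k (kinv BY).
  have [fX gX] := @kinv_spec R X BX k; have [fY gY] := @kinv_spec R Y BY k.
  by apply/idP/idP => h; [apply/fY/same/gX|apply/fX/same/gY].
case: (kinv BX) (kinv BY) spec => [x|] [y|] // h.
- by congr Some; apply/eqP; rewrite eqn_leq; have /= -> := esym (h x); have /= <- := esym (h y); rewrite !leqnn.
- by have := h x.+1; rewrite /= ltnn.
- by have := h y.+1; rewrite /= ltnn.
Qed.
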